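(* (In ZF.) The following conditions are equivalent. (AC) The Axiom of Choice. (AC1) Every graph has the distinguishing number. (AC2) Every graph without a component isomorphic to $K_1$ or $K_2$ has the distinguishing index. (AC3) Every graph has the chromatic index. (AC4) Every graph has the chromatic number. (AC5) For every acceptable family $\mathcal{A}$ the graph $G_{\mathcal{A}}$ has the distinguishing number. (AC6) For every acceptable family $\mathcal{A}$ the graph $G_{\mathcal{A}}$ has the distinguishing index. (AC7) For every acceptable family $\mathcal{A}$ the graph $G_{\mathcal{A}}$ has the chromatic index. (AC8) For every acceptable family $\mathcal{A}$ the graph $H_{\mathcal{A}}$ has the chromatic number.
   Context: Work in ZF, without the Axiom of Choice. A cardinal number is an initial ordinal, i.e. an ordinal not equinumerous with any smaller ordinal. Graphs are simple and undirected. Colourings are not assumed proper unless stated. An automorphism $\varphi$ of $G$ preserves a vertex (edge) colouring if each vertex (edge) is mapped to a vertex (edge) of the same colour; a colouring is distinguishing if the only automorphism of $G$ preserving it is the identity. The distinguishing number (resp. distinguishing index) of $G$ is the least cardinal number of colours in a distinguishing vertex (resp. edge) colouring of $G$ whose colours are ordinals (or elements of a well-ordered set); $G$ ''has the distinguishing number'' (resp. index) if such a colouring with colours from a cardinal number (equivalently, from some well-ordered set) exists. Likewise, $G$ has the chromatic number (resp. chromatic index) if it has a proper vertex (resp. edge) colouring with colours from some cardinal number, and the chromatic number (index) is the least number of colours in such a colouring. A family $\mathcal{A}=\{A_i : i\in\omega\}$ is acceptable if it is a countable family (indexed by $\omega$) of pairwise disjoint non-empty sets. Given an acceptable family $\mathcal{A}=\{A_i:i\in\omega\}$,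 let $Y=\bigcup\mathcal{A}$, and let $Z=\{z_i:i\in\omega\}$ and $Z'=\{z'_i:i\in\omega\}$ be disjoint sets (each enumerated without repetition), also disjoint from $Y$. The graphs $G_{\mathcal{A}}$ and $H_{\mathcal{A}}$ are defined by $V(G_{\mathcal{A}})=V(H_{\mathcal{A}})=Y\cup Z\cup Z'$, $E(G_{\mathcal{A}})=\{z_iz_{i+1}:i\in\omega\}\cup\{z_iz'_i:i\in\omega\}\cup\{a_iz'_i:i\in\omega, a_i\in A_i\}$, $E(H_{\mathcal{A}})=E(G_{\mathcal{A}})\cup\{ab: a\neq b,\ a,b\in A_i,\ i\in\omega\}$. *)

(* Defs.v *)
(** * Models of first-order ZF

    A theorem of ZF is a statement true in every model of ZF.  The universe of
    sets is therefore an arbitrary type with a binary relation satisfying the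
    first-order axioms; Separation and Replacement are schemes over first-order
    formulas with parameters, so no choice principle of the ambient logic is
    reflected inside a model.  All notions below quantify only over elements of
    the model. *)

Record set_structure : Type := SetStructure {
  carrier :> Type;
  mem : carrier -> carrier -> Prop
}.

Arguments mem {_} _ _.

Notation "x ∈ y" := (mem x y) (at level 70, no associativity).
Notation "x ∉ y" := (~ mem x y) (at level 70, no associativity).

(** Formulas of the language of set theory, with de Bruijn variables. *)
Inductive formula : Type :=
  | FMem (i j : nat)
  | FEq (i j : nat)
  | FNot (f : formula)
  | FAnd (f g : formula)
  | FOr (f g : formula)
  | FImp (f g : formula)
  | FAll (f : formula)
  | FEx (f : formula).

Definition scons {T : Type} (x : T) (e : nat -> T) (n : nat) : T :=
  match n with
  | O => x
  | S m => e m
  end.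

Fixpoint sat {M : set_structure} (e : nat -> M) (f : formula) : Prop :=
  match f with
  | FMem i j => e i ∈ e j
  | FEq i j => e i = e j
  | FNot g => ~ sat e g
  | FAnd g h => sat e g /\ sat e h
  | FOr g h => sat e g \/ sat e h
  | FImp g h => sat e g -> sat e h
  | FAll g => forall x : M, sat (scons x e) g
  | FEx g => exists x : M, sat (scons x e) g
  end.

Definition subset {M : set_structure} (x y : M) : Prop :=
  forall z : M, z ∈ x -> z ∈ y.

Definition is_empty {M : set_structure} (x : M) : Prop :=
  forall z : M, z ∉ x.

Definition is_upair {M : set_structure} (p a b : M) : Prop :=
  forall z : M, z ∈ p <-> z = a \/ z = b.

Definition is_union {M : set_structure} (u x : M) : Prop :=
  forall z : M, z ∈ u <-> exists y : M, y ∈ x /\ z ∈ y.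

Definition is_power {M : set_structure} (p x : M) : Prop :=
  forall z : M, z ∈ p <-> subset z x.

Definition is_succ {M : set_structure} (s n : M) : Prop :=
  forall z : M, z ∈ s <-> z ∈ n \/ z = n.

Definition is_inductive {M : set_structure} (I : M) : Prop :=
  (exists o : M, is_empty o /\ o ∈ I) /\
  (forall n : M, n ∈ I -> exists s : M, is_succ s n /\ s ∈ I).

Record is_ZF (M : set_structure) : Prop := IsZF {
  ZF_extensionality :
    forall x y : M, (forall z : M, z ∈ x <-> z ∈ y) -> x = y;
  ZF_foundation :
    forall x : M, (exists y : M, y ∈ x) ->
      exists y : M, y ∈ x /\ forall z : M, z ∈ y -> z ∉ x;
  ZF_pairing : forall a b : M, exists p : M, is_upair p a b;
  ZF_union : forall x : M, exists u : M, is_union u x;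
  ZF_power : forall x : M, exists p : M, is_power p x;
  ZF_infinity : exists I : M, is_inductive I;
  ZF_separation :
    forall (f : formula) (e : nat -> M) (x : M),
      exists y : M, forall z : M, z ∈ y <-> z ∈ x /\ sat (scons z e) f;
  ZF_replacement :
    forall (f : formula) (e : nat -> M) (x : M),
      (forall a b c : M, a ∈ x ->
         sat (scons a (scons b e)) f -> sat (scons a (scons c e)) f -> b = c) ->
      exists y : M, forall b : M,
        b ∈ y <-> exists a : M, a ∈ x /\ sat (scons a (scons b e)) f
}.

(** ** Functions, ordinals, cardinals *)

Definition is_opair {M : set_structure} (p a b : M) : Prop :=
  exists s t : M, is_upair s a a /\ is_upair t a b /\ is_upair p s t.

Definition maps {M : set_structure} (f x y : M) : Prop :=
  exists p : M, is_opair p x y /\ p ∈ f.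

Definition is_function {M : set_structure} (f A B : M) : Prop :=
  (forall p : M, p ∈ f -> exists x y : M, x ∈ A /\ y ∈ B /\ is_opair p x y) /\
  (forall x : M, x ∈ A -> exists! y : M, maps f x y).

Definition is_injection {M : set_structure} (f A B : M) : Prop :=
  is_function f A B /\
  (forall x x' y : M, maps f x y -> maps f x' y -> x = x').

Definition is_bijection {M : set_structure} (f A B : M) : Prop :=
  is_injection f A B /\
  (forall y : M, y ∈ B -> exists x : M, maps f x y).

Definition equinumerous {M : set_structure} (A B : M) : Prop :=
  exists f : M, is_bijection f A B.

(** Well-foundedness of [∈] on [a] is Foundation. *)
Definition is_ordinal {M : set_structure} (a : M) : Prop :=
  (forall x : M, x ∈ a -> subset x a) /\
  (forall x y : M, x ∈ a -> y ∈ a -> x ∈ y \/ x = y \/ y ∈ x).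

Definition is_cardinal {M : set_structure} (k : M) : Prop :=
  is_ordinal k /\
  (forall b : M, is_ordinal b -> b ∈ k -> ~ equinumerous b k).

Definition is_omega {M : set_structure} (w : M) : Prop :=
  is_inductive w /\ (forall I : M, is_inductive I -> subset w I).

(** ** Graphs

    A graph is a vertex set [V] together with a set [E] of two-element subsets
    of [V]. *)

Definition is_graph {M : set_structure} (V E : M) : Prop :=
  forall e : M, e ∈ E ->
    exists x y : M, x ∈ V /\ y ∈ V /\ x <> y /\ is_upair e x y.

Definition adjacent {M : set_structure} (E x y : M) : Prop :=
  exists e : M, e ∈ E /\ is_upair e x y.

Definition is_isomorphism {M : set_structure} (f V E V' E' : M) : Prop :=
  is_bijection f V V' /\
  (forall x y x' y' : M, maps f x x' -> maps f y y' ->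
     (adjacent E x y <-> adjacent E' x' y')).

Definition isomorphic {M : set_structure} (V E V' E' : M) : Prop :=
  exists f : M, is_isomorphism f V E V' E'.

Definition is_automorphism {M : set_structure} (f V E : M) : Prop :=
  is_isomorphism f V E V E.

Definition is_identity_on {M : set_structure} (f V : M) : Prop :=
  forall x : M, x ∈ V -> maps f x x.

(** [p] enumerates, along [0, ..., n], the distinct vertices of a path. *)
Definition is_path {M : set_structure} (V E p n x y : M) : Prop :=
  (exists w : M, is_omega w /\ n ∈ w) /\
  (exists l : M, is_succ l n /\ is_injection p l V) /\
  (forall o : M, is_empty o -> maps p o x) /\
  maps p n y /\
  (forall i j a b : M, i ∈ n -> is_succ j i ->
     maps p i a -> maps p j b -> adjacent E a b).

Definition is_component {M : set_structure} (V E C : M) : Prop :=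
  exists x : M, x ∈ V /\
    forall y : M, y ∈ C <-> y ∈ V /\ exists p n : M, is_path V E p n x y.

Definition is_induced_edge_set {M : set_structure} (E C F : M) : Prop :=
  forall e : M, e ∈ F <-> e ∈ E /\ subset e C.

Definition is_complete_graph {M : set_structure} (V E : M) : Prop :=
  is_graph V E /\
  (forall x y : M, x ∈ V -> y ∈ V -> x <> y -> adjacent E x y).

Definition is_one {M : set_structure} (n : M) : Prop :=
  exists o : M, is_empty o /\ is_succ n o.

Definition is_two {M : set_structure} (n : M) : Prop :=
  exists k : M, is_one k /\ is_succ n k.

Definition has_K1_or_K2_component {M : set_structure} (V E : M) : Prop :=
  exists C F n D : M,
    is_component V E C /\ is_induced_edge_set E C F /\
    (is_one n \/ is_two n) /\ is_complete_graph n D /\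
    isomorphic C F n D.

(** ** Colourings

    A colouring is a function from the vertices (edges) to a cardinal. *)

Definition preserves_vertex_colouring {M : set_structure} (f c : M) : Prop :=
  forall x y k : M, maps f x y -> maps c x k -> maps c y k.

Definition is_edge_image {M : set_structure} (f e e' : M) : Prop :=
  forall y : M, y ∈ e' <-> exists x : M, x ∈ e /\ maps f x y.

Definition preserves_edge_colouring {M : set_structure} (f c E : M) : Prop :=
  forall e e' k : M, e ∈ E -> is_edge_image f e e' -> maps c e k -> maps c e' k.

Definition has_distinguishing_number {M : set_structure} (V E : M) : Prop :=
  exists K c : M, is_cardinal K /\ is_function c V K /\
    forall f : M, is_automorphism f V E -> preserves_vertex_colouring f c ->
      is_identity_on f V.

Definition has_distinguishing_index {M : set_structure} (V E : M) : Prop :=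
  exists K c : M, is_cardinal K /\ is_function c E K /\
    forall f : M, is_automorphism f V E -> preserves_edge_colouring f c E ->
      is_identity_on f V.

Definition has_chromatic_number {M : set_structure} (V E : M) : Prop :=
  exists K c : M, is_cardinal K /\ is_function c V K /\
    forall x y k l : M, adjacent E x y -> maps c x k -> maps c y l -> k <> l.

Definition has_chromatic_index {M : set_structure} (V E : M) : Prop :=
  exists K c : M, is_cardinal K /\ is_function c E K /\
    forall e e' k l : M, e ∈ E -> e' ∈ E -> e <> e' ->
      (exists x : M, x ∈ e /\ x ∈ e') ->
      maps c e k -> maps c e' l -> k <> l.

(** ** The graphs of an acceptable family

    A family indexed by [w] (the set ω of the model) is a function with domain
    [w]; [maps A i S] reads [S = A_i]. *)

Definition is_acceptable {M : set_structure} (w A : M) : Prop :=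
  (exists B : M, is_function A w B) /\
  (forall i S : M, maps A i S -> exists x : M, x ∈ S) /\
  (forall i j S T : M, maps A i S -> maps A j T -> i <> j ->
     forall x : M, ~ (x ∈ S /\ x ∈ T)).

(** [z] and [z'] enumerate without repetition the sets [Z] and [Z'], which are
    disjoint from each other and from the union of the family. *)
Definition is_auxiliary {M : set_structure} (w A z z' : M) : Prop :=
  (exists Z : M, is_injection z w Z) /\
  (exists Z' : M, is_injection z' w Z') /\
  (forall i j x : M, ~ (maps z i x /\ maps z' j x)) /\
  (forall i j S x : M, maps A i S -> x ∈ S -> ~ maps z j x /\ ~ maps z' j x).

Definition is_family_vertex_set {M : set_structure} (A z z' V : M) : Prop :=
  forall x : M, x ∈ V <->
    (exists i S : M, maps A i S /\ x ∈ S) \/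
    (exists i : M, maps z i x) \/
    (exists i : M, maps z' i x).

Definition is_edge_of_G {M : set_structure} (A z z' e : M) : Prop :=
  (exists i j a b : M,
     is_succ j i /\ maps z i a /\ maps z j b /\ is_upair e a b) \/
  (exists i a b : M, maps z i a /\ maps z' i b /\ is_upair e a b) \/
  (exists i S a b : M,
     maps A i S /\ a ∈ S /\ maps z' i b /\ is_upair e a b).

Definition is_clique_edge {M : set_structure} (A e : M) : Prop :=
  exists i S a b : M,
    maps A i S /\ a ∈ S /\ b ∈ S /\ a <> b /\ is_upair e a b.

(** [(V, E)] is the graph G_A formed with the enumerations [z] and [z']. *)
Definition is_graph_G {M : set_structure} (A z z' V E : M) : Prop :=
  is_family_vertex_set A z z' V /\
  (forall e : M, e ∈ E <-> is_edge_of_G A z z' e).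

(** [(V, E)] is the graph H_A formed with the enumerations [z] and [z']. *)
Definition is_graph_H {M : set_structure} (A z z' V E : M) : Prop :=
  is_family_vertex_set A z z' V /\
  (forall e : M, e ∈ E <-> is_edge_of_G A z z' e \/ is_clique_edge A e).

(** ** The conditions *)

Definition AC (M : set_structure) : Prop :=
  forall F : M, (forall X : M, X ∈ F -> exists x : M, x ∈ X) ->
    exists f B : M, is_function f F B /\
      forall X x : M, maps f X x -> x ∈ X.

Definition AC1 (M : set_structure) : Prop :=
  forall V E : M, is_graph V E -> has_distinguishing_number V E.

Definition AC2 (M : set_structure) : Prop :=
  forall V E : M, is_graph V E -> ~ has_K1_or_K2_component V E ->
    has_distinguishing_index V E.

Definition AC3 (M : set_structure) : Prop :=
  forall V E : M, is_graph V E -> has_chromatic_index V E.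

Definition AC4 (M : set_structure) : Prop :=
  forall V E : M, is_graph V E -> has_chromatic_number V E.

Definition AC5 (M : set_structure) : Prop :=
  forall w A z z' V E : M,
    is_omega w -> is_acceptable w A -> is_auxiliary w A z z' ->
    is_graph_G A z z' V E -> has_distinguishing_number V E.

Definition AC6 (M : set_structure) : Prop :=
  forall w A z z' V E : M,
    is_omega w -> is_acceptable w A -> is_auxiliary w A z z' ->
    is_graph_G A z z' V E -> has_distinguishing_index V E.

Definition AC7 (M : set_structure) : Prop :=
  forall w A z z' V E : M,
    is_omega w -> is_acceptable w A -> is_auxiliary w A z z' ->
    is_graph_G A z z' V E -> has_chromatic_index V E.

Definition AC8 (M : set_structure) : Prop :=
  forall w A z z' V E : M,
    is_omega w -> is_acceptable w A -> is_auxiliary w A z z' ->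
    is_graph_H A z z' V E -> has_chromatic_number V E.

(* Main.v *)
From Stdlib Require Import Arith Lia ClassicalEpsilon.
Require Import Defs.

(** Why the theorem is true.

    From choice to colourings.  A choice function for the nonempty subsets of
    a set [V] enumerates [V] by transfinite recursion, so [V] injects into an
    ordinal and then into a cardinal ([AC_injection_into_cardinal]).
    Colouring all vertices, or all edges, differently is a proper colouring, and
    the vertex version is distinguishing.  For edges, an automorphism fixing every
    edge can move a vertex [x] only if [x] is isolated or if the component of
    [x] is a single edge whose ends are exchanged; both are excluded when no
    component is K1 or K2 ([AC_implies_AC2]).

    From colourings to choice.  In G_A the members of one [A_i] are twins:
    each has the vertex [z'_i] as its only neighbour.  Exchanging two twins is an
    automorphism ([twins_swap]), so a distinguishing vertex colouring is
    injective on [A_i], and a distinguishing edge colouring is injective on the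
    edges from [A_i] to [z'_i].  A proper edge colouring is injective on these
    edges because they share [z'_i], and a proper vertex colouring of H_A is
    injective on [A_i] because [A_i] is a clique.  In each case [A_i] injects into an
    ordinal.  Every nonempty set [X] occurs, up to bijection, as a member of
    the acceptable family of the sets [X × {i}] ([copies_family]); hence every
    nonempty set injects into an ordinal, and choosing elements with least label
    gives a choice function ([AC_of_injections_into_ordinals]).

    The graph conditions imply their instances for G_A and H_A; the one point to
    check is that no component of G_A is K1 or K2, since every vertex reaches two
    others within two steps ([graph_G_no_small_component]).

    All sets must be formed inside the model, where Separation and Replacement
    accept only first-order formulas.  The predicate [definable] isolates what
    these schemes need; it is closed under the logical connectives and under
    quantification over the model, so that the formulas never have to be
    written down. *)

(** * Definability with parameters *)

Fixpoint rename (r : nat -> nat) (f : formula) : formula :=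
  match f with
  | FMem i j => FMem (r i) (r j)
  | FEq i j => FEq (r i) (r j)
  | FNot g => FNot (rename r g)
  | FAnd g h => FAnd (rename r g) (rename r h)
  | FOr g h => FOr (rename r g) (rename r h)
  | FImp g h => FImp (rename r g) (rename r h)
  | FAll g => FAll (rename (scons 0 (fun n => S (r n))) g)
  | FEx g => FEx (rename (scons 0 (fun n => S (r n))) g)
  end.

Lemma sat_rename {M : set_structure} (f : formula) :
  forall (r : nat -> nat) (e e' : nat -> M),
    (forall n, e' n = e (r n)) -> sat e' f <-> sat e (rename r f).
Proof.
  assert (lift : forall (r : nat -> nat) (e e' : nat -> M) (x : M),
    (forall n, e' n = e (r n)) ->
    forall n, scons x e' n = scons x e (scons 0 (fun n => S (r n)) n)).
  { intros r e e' x H [|n]; simpl; auto. }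
  induction f as [i j|i j|g IH|g IHg h IHh|g IHg h IHh|g IHg h IHh|g IH|g IH];
    intros r e e' H; simpl.
  - rewrite !H; tauto.
  - rewrite !H; tauto.
  - rewrite (IH r e e' H); tauto.
  - rewrite (IHg r e e' H), (IHh r e e' H); tauto.
  - rewrite (IHg r e e' H), (IHh r e e' H); tauto.
  - rewrite (IHg r e e' H), (IHh r e e' H); tauto.
  - split; intros A x; specialize (A x);
      apply (IH _ (scons x e) (scons x e') (lift r e e' x H)); exact A.
  - split; intros [x A]; exists x;
      apply (IH _ (scons x e) (scons x e') (lift r e e' x H)); exact A.
Qed.

(** An assignment sends each free variable of a formula either to a coordinate of
    the environment or to a fixed element of the model.  Keeping the parameters
    in the assignment lets two formulas with different parameters be combined by
    a mere renaming of variables. *)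
Definition valuation {M : set_structure} (s : nat -> nat + M) (e : nat -> M)
    (n : nat) : M :=
  match s n with
  | inl i => e i
  | inr a => a
  end.

Definition definable {M : set_structure} (P : (nat -> M) -> Prop) : Prop :=
  exists (f : formula) (s : nat -> nat + M),
    forall e : nat -> M, P e <-> sat (valuation s e) f.

Definition simple_term {M : set_structure} (t : (nat -> M) -> M) : Prop :=
  exists u : nat + M,
    forall e : nat -> M, t e = match u with inl i => e i | inr a => a end.

Section Definability.

Context {M : set_structure}.
Implicit Types (P Q : (nat -> M) -> Prop) (e : nat -> M).

Lemma simple_term_variable (i : nat) : simple_term (fun e => e i).
Proof. exists (inl i); reflexivity. Qed.

Lemma simple_term_constant (a : M) : simple_term (fun _ => a).
Proof. exists (inr a); reflexivity. Qed.

Lemma definable_mem (t u : (nat -> M) -> M) :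
  simple_term t -> simple_term u -> definable (fun e => t e ∈ u e).
Proof.
  intros [s1 H1] [s2 H2].
  exists (FMem 0 1), (scons s1 (fun _ => s2)).
  intro e; simpl; unfold valuation; simpl; rewrite H1, H2; tauto.
Qed.

Lemma definable_eq (t u : (nat -> M) -> M) :
  simple_term t -> simple_term u -> definable (fun e => t e = u e).
Proof.
  intros [s1 H1] [s2 H2].
  exists (FEq 0 1), (scons s1 (fun _ => s2)).
  intro e; simpl; unfold valuation; simpl; rewrite H1, H2; tauto.
Qed.

Lemma definable_not P : definable P -> definable (fun e => ~ P e).
Proof.
  intros (f & s & H); exists (FNot f), s; intro e; simpl; rewrite (H e); tauto.
Qed.

(** Even-numbered variables are reserved for the first formula and odd-numbered
    ones for the second, so that one assignment serves both. *)
Lemma definable_pair P Q :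
  definable P -> definable Q ->
  exists f g s, forall e,
    (P e <-> sat (valuation s e) f) /\ (Q e <-> sat (valuation s e) g).
Proof.
  intros (f & s & Hf) (g & t & Hg).
  exists (rename (fun n => 2 * n) f), (rename (fun n => S (2 * n)) g),
    (fun n => if Nat.even n then s (Nat.div2 n) else t (Nat.div2 n)).
  intro e; rewrite (Hf e), (Hg e); split; apply sat_rename; intro n;
    unfold valuation.
  - rewrite Nat.even_even, Nat.div2_double; reflexivity.
  - replace (S (2 * n)) with (2 * n + 1) at 1 by lia.
    rewrite Nat.even_odd, Nat.div2_succ_double; reflexivity.
Qed.

Lemma definable_and P Q :
  definable P -> definable Q -> definable (fun e => P e /\ Q e).
Proof.
  intros HP HQ; destruct (definable_pair P Q HP HQ) as (f & g & s & H).
  exists (FAnd f g), s; intro e; simpl; destruct (H e); tauto.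
Qed.

Lemma definable_or P Q :
  definable P -> definable Q -> definable (fun e => P e \/ Q e).
Proof.
  intros HP HQ; destruct (definable_pair P Q HP HQ) as (f & g & s & H).
  exists (FOr f g), s; intro e; simpl; destruct (H e); tauto.
Qed.

Lemma definable_imp P Q :
  definable P -> definable Q -> definable (fun e => P e -> Q e).
Proof.
  intros HP HQ; destruct (definable_pair P Q HP HQ) as (f & g & s & H).
  exists (FImp f g), s; intro e; simpl; destruct (H e); tauto.
Qed.

Lemma definable_iff P Q :
  definable P -> definable Q -> definable (fun e => P e <-> Q e).
Proof.
  intros HP HQ; apply definable_and; apply definable_imp; assumption.
Qed.

(** Several variables of the formula may be assigned to the coordinate about to
    be bound; all of them are renamed to the bound variable, and the
    others are moved up by one. *)
Lemma definable_bound (P : (nat -> M) -> M -> Prop) :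
  definable (fun e => P (fun n => e (S n)) (e 0)) ->
  exists f s, forall e x, P e x <-> sat (scons x (valuation s e)) f.
Proof.
  intros (f & s & H).
  exists (rename
      (fun n => match s n with inl 0 => 0 | _ => S n end) f),
    (fun n => match s n with inl i => inl (pred i) | inr a => inr a end).
  intros e x; rewrite (H (scons x e)); apply sat_rename; intro n.
  unfold valuation; destruct (s n) as [[|i]|a] eqn:E; simpl;
    try rewrite E; reflexivity.
Qed.

Lemma definable_forall (P : (nat -> M) -> M -> Prop) :
  definable (fun e => P (fun n => e (S n)) (e 0)) ->
  definable (fun e => forall x, P e x).
Proof.
  intros H; destruct (definable_bound P H) as (f & s & Hf).
  exists (FAll f), s; intro e; simpl; split; intros A x; apply Hf, A.
Qed.

Lemma definable_exists (P : (nat -> M) -> M -> Prop) :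
  definable (fun e => P (fun n => e (S n)) (e 0)) ->
  definable (fun e => exists x, P e x).
Proof.
  intros H; destruct (definable_bound P H) as (f & s & Hf).
  exists (FEx f), s; intro e; simpl; split; intros [x A]; exists x; apply Hf, A.
Qed.

Lemma definable_substitution P (s : nat -> nat + M) :
  definable P -> definable (fun e => P (valuation s e)).
Proof.
  intros (f & t & H).
  exists (rename (fun n => n) f),
    (fun n => match t n with inl i => s i | inr a => inr a end).
  intro e; rewrite (H (valuation s e)); apply sat_rename; intro n.
  unfold valuation; destruct (t n); reflexivity.
Qed.

(** A hypothesis that [R] is definable in the two first coordinates is usable at
    any two arguments; this is how [definability] treats a relation
    that is a variable. *)
Lemma definable_binary (R : M -> M -> Prop) (t u : (nat -> M) -> M) :
  definable (fun e => R (e 0) (e 1)) -> simple_term t -> simple_term u ->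
  definable (fun e => R (t e) (u e)).
Proof.
  intros H [s1 H1] [s2 H2].
  destruct (definable_substitution _ (scons s1 (fun _ => s2)) H) as (f & s & Hf).
  exists f, s; intro e; rewrite <- (Hf e), H1, H2; reflexivity.
Qed.

End Definability.

(** The rules also apply to defined notions, which unification unfolds until a logical
    symbol, membership or equality appears at the head. *)
Ltac definability :=
  cbv beta delta [unique];
  repeat (cbv beta; first
    [ assumption
    | apply simple_term_variable
    | apply simple_term_constant
    | apply definable_mem
    | apply definable_eq
    | apply definable_not
    | apply definable_and
    | apply definable_or
    | apply definable_iff
    | apply definable_exists
    | apply definable_forall
    | apply definable_imp
    | apply definable_binary; [assumption | |] ]).

(** * Elementary set theory in a model *)

Section ZF.

Context {M : set_structure} (HM : is_ZF M).

Lemma separation (P : M -> Prop) (x : M) :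
  definable (fun e => P (e 0)) ->
  exists y, forall z, z ∈ y <-> z ∈ x /\ P z.
Proof.
  intro H; destruct (definable_bound (fun _ => P) H) as (f & s & Hf).
  destruct (ZF_separation M HM f (valuation s (fun _ => x)) x) as [y Hy].
  exists y; intro z; rewrite (Hy z), (Hf (fun _ => x) z); tauto.
Qed.

Lemma replacement (R : M -> M -> Prop) (x : M) :
  definable (fun e => R (e 0) (e 1)) ->
  (forall a b c, a ∈ x -> R a b -> R a c -> b = c) ->
  exists y, forall b, b ∈ y <-> exists a, a ∈ x /\ R a b.
Proof.
  intros H HR.
  destruct (definable_bound (fun e a => R a (e 0)) H) as (f & s & Hf).
  assert (K : exists g t, forall a b,
    R a b <-> sat (scons a (scons b (valuation t (fun _ => x)))) g).
  { exists (rename (scons 0 (fun n =>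
        S match s n with inl 0 => 0 | _ => S n end)) f),
      (fun n => match s n with inl i => inl (pred i) | inr a => inr a end).
    intros a b; rewrite (Hf (scons b (fun _ => x)) a); apply sat_rename.
    intros [|n]; simpl; [reflexivity|].
    unfold valuation; destruct (s n) as [[|i]|c] eqn:E; simpl;
      try rewrite E; reflexivity. }
  destruct K as (g & t & K).
  destruct (ZF_replacement M HM g (valuation t (fun _ => x)) x) as [y Hy].
  { intros a b c Ha Hb Hc; apply (HR a); [exact Ha| |]; apply K; assumption. }
  exists y; intro b; rewrite (Hy b); split; intros (a & Ha & Hab); exists a;
    split; auto; apply K; exact Hab.
Qed.

Lemma set_ext (x y : M) : (forall z, z ∈ x <-> z ∈ y) -> x = y.
Proof. apply (ZF_extensionality M HM). Qed.

Lemma minimal_element (P : M -> Prop) (x : M) :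
  definable (fun e => P (e 0)) ->
  (exists y, y ∈ x /\ P y) ->
  exists y, y ∈ x /\ P y /\ forall z, z ∈ y -> z ∈ x -> ~ P z.
Proof.
  intros HP (y & Hy & Py).
  destruct (separation P x HP) as [s Hs].
  destruct (ZF_foundation M HM s) as (m & Hm & Hmin).
  { exists y; apply Hs; auto. }
  apply Hs in Hm; destruct Hm as [Hm Pm].
  exists m; repeat split; auto.
  intros z Hz Hzx Pz; apply (Hmin z Hz), Hs; auto.
Qed.

(** The pair is unique by Extensionality, so naming it by description in the ambient
    logic gives the model no choice principle of its own.  The same holds for
    [cup] and [empty]. *)
Definition upair (a b : M) : M :=
  proj1_sig (constructive_indefinite_description _ (ZF_pairing M HM a b)).

Lemma in_upair (a b z : M) : z ∈ upair a b <-> z = a \/ z = b.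
Proof.
  unfold upair; destruct constructive_indefinite_description as [p Hp]; apply Hp.
Qed.

Lemma is_upair_eq (p a b : M) : is_upair p a b <-> p = upair a b.
Proof.
  split.
  - intro H; apply set_ext; intro z; rewrite (H z), in_upair; tauto.
  - intros -> z; apply in_upair.
Qed.

Lemma is_upair_cases (p a b c d : M) :
  is_upair p a b -> is_upair p c d -> a = c /\ b = d \/ a = d /\ b = c.
Proof.
  intros H1 H2.
  assert (Ha : a = c \/ a = d) by (apply H2, H1; auto).
  assert (Hb : b = c \/ b = d) by (apply H2, H1; auto).
  assert (Hc : c = a \/ c = b) by (apply H1, H2; auto).
  assert (Hd : d = a \/ d = b) by (apply H1, H2; auto).
  intuition congruence.
Qed.

Lemma is_upair_sym (p a b : M) : is_upair p a b -> is_upair p b a.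
Proof. intros H z; rewrite (H z); tauto. Qed.

Definition opair (a b : M) : M := upair (upair a a) (upair a b).

Lemma is_opair_eq (p a b : M) : is_opair p a b <-> p = opair a b.
Proof.
  split.
  - intros (s & t & Hs & Ht & Hp).
    apply is_upair_eq in Hs, Ht, Hp; subst; reflexivity.
  - intros ->; exists (upair a a), (upair a b).
    rewrite !is_upair_eq; auto.
Qed.

Lemma opair_inj (a b c d : M) : opair a b = opair c d -> a = c /\ b = d.
Proof.
  intro H.
  assert (K : upair a a = upair c c /\ upair a b = upair c d \/
              upair a a = upair c d /\ upair a b = upair c c).
  { apply (is_upair_cases (opair a b)); apply is_upair_eq; auto. }
  assert (L : forall p q r s : M, upair p q = upair r s ->
            p = r /\ q = s \/ p = s /\ q = r).
  { intros p q r s E; apply (is_upair_cases (upair p q)); apply is_upair_eq; auto. }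
  destruct K as [[K1 K2]|[K1 K2]]; apply L in K1, K2; intuition congruence.
Qed.

Lemma maps_eq (f x y : M) : maps f x y <-> opair x y ∈ f.
Proof.
  split.
  - intros (p & Hp & H); apply is_opair_eq in Hp; subst; exact H.
  - intro H; exists (opair x y); rewrite is_opair_eq; auto.
Qed.

Lemma cup_exists (a b : M) : exists u : M, forall z, z ∈ u <-> z ∈ a \/ z ∈ b.
Proof.
  destruct (ZF_union M HM (upair a b)) as [u Hu].
  exists u; intro z; rewrite (Hu z); split.
  - intros (y & Hy & Hz); apply in_upair in Hy; destruct Hy; subst; auto.
  - intros [H|H]; [exists a|exists b]; rewrite in_upair; auto.
Qed.

Definition cup (a b : M) : M :=
  proj1_sig (constructive_indefinite_description _ (cup_exists a b)).

Lemma in_cup (a b z : M) : z ∈ cup a b <-> z ∈ a \/ z ∈ b.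
Proof.
  unfold cup; destruct constructive_indefinite_description as [p Hp]; apply Hp.
Qed.

Definition succ (n : M) : M := cup n (upair n n).

Lemma in_succ (n z : M) : z ∈ succ n <-> z ∈ n \/ z = n.
Proof. unfold succ; rewrite in_cup, in_upair; tauto. Qed.

Lemma is_succ_eq (s n : M) : is_succ s n <-> s = succ n.
Proof.
  split.
  - intro H; apply set_ext; intro z; rewrite (H z), in_succ; tauto.
  - intros -> z; apply in_succ.
Qed.

Lemma empty_exists : exists o : M, is_empty o.
Proof.
  destruct (ZF_infinity M HM) as (I & (o & Ho & _) & _); exists o; exact Ho.
Qed.

Definition empty : M :=
  proj1_sig (constructive_indefinite_description _ empty_exists).

Lemma not_in_empty (z : M) : z ∉ empty.
Proof.
  unfold empty; destruct constructive_indefinite_description as [p Hp]; apply Hp.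
Qed.

Lemma is_empty_eq (o : M) : is_empty o <-> o = empty.
Proof.
  split.
  - intro H; apply set_ext; intro z; split; intro K.
    + destruct (H z K).
    + destruct (not_in_empty z K).
  - intros -> z; apply not_in_empty.
Qed.

(** A cycle would be a set without an [∈]-minimal element. *)
Lemma mem_acyclic3 (x y z : M) : x ∈ y -> y ∈ z -> z ∉ x.
Proof.
  intros Hxy Hyz Hzx.
  destruct (ZF_foundation M HM (cup (upair x y) (upair z z))) as (m & Hm & Hmin).
  { exists x; rewrite in_cup, !in_upair; auto. }
  rewrite in_cup, !in_upair in Hm.
  destruct Hm as [[->| ->]|[->| ->]];
    [apply (Hmin z)|apply (Hmin x)|apply (Hmin y)|apply (Hmin y)]; auto;
    rewrite in_cup, !in_upair; auto.
Qed.

Lemma mem_irrefl (x : M) : x ∉ x.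
Proof. intro H; exact (mem_acyclic3 x x x H H H). Qed.

Lemma mem_asym (x y : M) : x ∈ y -> y ∉ x.
Proof.
  intros H1 H2.
  destruct (ZF_foundation M HM (upair x y)) as (m & Hm & Hmin).
  { exists x; rewrite in_upair; auto. }
  rewrite in_upair in Hm.
  destruct Hm as [->| ->]; [apply (Hmin y)|apply (Hmin x)]; auto;
    rewrite in_upair; auto.
Qed.

Lemma product_exists (A B : M) :
  exists Q : M, forall p, p ∈ Q <-> exists x y, x ∈ A /\ y ∈ B /\ p = opair x y.
Proof.
  destruct (ZF_power M HM (cup A B)) as [P1 HP1].
  destruct (ZF_power M HM P1) as [P2 HP2].
  destruct (separation
    (fun p => exists x y, x ∈ A /\ y ∈ B /\ is_opair p x y) P2) as [Q HQ].
  { definability. }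
  exists Q; intro p; rewrite (HQ p); split.
  - intros (_ & x & y & Hx & Hy & Hp); exists x, y; rewrite <- is_opair_eq; auto.
  - intros (x & y & Hx & Hy & ->); split.
    + apply HP2; intros s Hs; apply HP1; intros z Hz.
      unfold opair in Hs; rewrite in_upair in Hs; rewrite in_cup.
      destruct Hs as [-> | ->]; rewrite in_upair in Hz;
        destruct Hz as [-> | ->]; auto.
    + exists x, y; rewrite is_opair_eq; auto.
Qed.

(** The restriction to [A × B] is what makes an arbitrary definable relation a
    set. *)
Lemma relation_exists (A B : M) (R : M -> M -> Prop) :
  definable (fun e => R (e 0) (e 1)) ->
  exists f : M,
    (forall p, p ∈ f -> exists x y, x ∈ A /\ y ∈ B /\ is_opair p x y) /\
    (forall x y, maps f x y <-> x ∈ A /\ y ∈ B /\ R x y).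
Proof.
  intro HR.
  destruct (product_exists A B) as [Q HQ].
  destruct (separation (fun p => exists x y, is_opair p x y /\ R x y) Q)
    as [f Hf].
  { definability. }
  exists f; split.
  - intros p Hp; apply Hf in Hp; destruct Hp as [Hp _].
    apply HQ in Hp; destruct Hp as (x & y & Hx & Hy & Hp).
    exists x, y; rewrite is_opair_eq; auto.
  - intros x y; rewrite maps_eq, (Hf (opair x y)), (HQ (opair x y)); split.
    + intros [(x1 & y1 & Hx & Hy & E1) (x2 & y2 & E2 & HRxy)].
      rewrite is_opair_eq in E2.
      apply opair_inj in E1, E2; destruct E1, E2; subst; auto.
    + intros (Hx & Hy & Hxy); split; exists x, y; auto.
      rewrite is_opair_eq; auto.
Qed.

Lemma function_exists (A B : M) (R : M -> M -> Prop) :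
  definable (fun e => R (e 0) (e 1)) ->
  (forall x, x ∈ A -> exists y, y ∈ B /\ R x y) ->
  (forall x y y', x ∈ A -> R x y -> R x y' -> y = y') ->
  exists f : M, is_function f A B /\
    (forall x y, maps f x y <-> x ∈ A /\ y ∈ B /\ R x y).
Proof.
  intros HR Htot Huniq.
  destruct (relation_exists A B R HR) as (f & Hsub & Hf).
  exists f; split; [split|]; auto.
  intros x Hx; destruct (Htot x Hx) as (y & Hy & Hxy).
  exists y; split.
  - apply Hf; auto.
  - intros y' H'; apply Hf in H'; destruct H' as (_ & _ & H').
    apply (Huniq x); auto.
Qed.

Lemma function_value (f A B x : M) :
  is_function f A B -> x ∈ A -> exists y, y ∈ B /\ maps f x y.
Proof.
  intros [Hsub Htot] Hx; destruct (Htot x Hx) as (y & Hy & _).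
  exists y; split; auto.
  destruct Hy as (p & Hp & Hpf); destruct (Hsub p Hpf) as (x' & y' & _ & Hy' & Hp').
  apply is_opair_eq in Hp, Hp'; subst.
  apply opair_inj in Hp'; destruct Hp'; subst; auto.
Qed.

Lemma function_bounds (f A B x y : M) :
  is_function f A B -> maps f x y -> x ∈ A /\ y ∈ B.
Proof.
  intros [Hsub _] (p & Hp & Hpf).
  destruct (Hsub p Hpf) as (x' & y' & Hx & Hy & Hp').
  apply is_opair_eq in Hp, Hp'; subst.
  apply opair_inj in Hp'; destruct Hp'; subst; auto.
Qed.

Lemma function_unique (f A B x y y' : M) :
  is_function f A B -> maps f x y -> maps f x y' -> y = y'.
Proof.
  intros Hf H H'; destruct (function_bounds f A B x y Hf H) as [Hx _].
  destruct Hf as [_ Htot]; destruct (Htot x Hx) as (z & _ & Hz).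
  rewrite <- (Hz y H); apply Hz; exact H'.
Qed.


(** * Ordinals *)

Lemma ordinal_element (a b : M) : is_ordinal a -> b ∈ a -> is_ordinal b.
Proof.
  intros [Htr Htri] Hb; split.
  - intros x Hx z Hz.
    assert (Hxa : x ∈ a) by (apply (Htr b); auto).
    assert (Hza : z ∈ a) by (apply (Htr x); auto).
    destruct (Htri z b Hza Hb) as [H|[->|H]]; auto.
    + destruct (mem_asym _ _ Hx Hz).
    + destruct (mem_acyclic3 _ _ _ Hz Hx H).
  - intros x y Hx Hy; apply Htri; apply (Htr b); auto.
Qed.

(** The least element of [a] outside [c] has the same elements as [c]. *)
Lemma transitive_subset_of_ordinal (a c : M) :
  is_ordinal a -> subset c a -> (forall x, x ∈ c -> subset x c) ->
  c = a \/ c ∈ a.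
Proof.
  intros [Htr Htri] Hca Hc.
  destruct (classic (exists x, x ∈ a /\ x ∉ c)) as [H|H].
  - right.
    destruct (minimal_element (fun x => x ∉ c) a) as (m & Hm & Hmc & Hmin).
    { definability. }
    { exact H. }
    replace c with m; [exact Hm|].
    apply set_ext; intro z; split; intro Hz.
    + apply NNPP; apply Hmin; [exact Hz|]. apply (Htr m); auto.
    + destruct (Htri z m (Hca z Hz) Hm) as [K|[->|K]]; auto.
      * contradiction.
      * destruct Hmc; apply (Hc z); auto.
  - left; apply set_ext; intro z; split; intro Hz; [auto|].
    apply NNPP; intro K; apply H; exists z; auto.
Qed.

(** The intersection of the two ordinals is a transitive subset of both; if it were
    an element of both it would be an element of itself. *)
Lemma ordinal_comparable (a b : M) :
  is_ordinal a -> is_ordinal b -> a ∈ b \/ a = b \/ b ∈ a.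
Proof.
  intros Ha Hb.
  destruct (separation (fun x => x ∈ b) a) as [c Hc]; [definability|].
  assert (Htr : forall x, x ∈ c -> subset x c).
  { intros x Hx z Hz; apply Hc in Hx; destruct Hx as [Hxa Hxb].
    apply Hc; split; [apply (proj1 Ha x)|apply (proj1 Hb x)]; auto. }
  assert (Hca : subset c a) by (intros x Hx; apply Hc in Hx; tauto).
  assert (Hcb : subset c b) by (intros x Hx; apply Hc in Hx; tauto).
  destruct (transitive_subset_of_ordinal a c Ha Hca Htr) as [Ea|Ia];
    destruct (transitive_subset_of_ordinal b c Hb Hcb Htr) as [Eb|Ib];
    subst; auto.
  destruct (mem_irrefl c); apply Hc; auto.
Qed.

Lemma ordinal_succ (a : M) : is_ordinal a -> is_ordinal (succ a).
Proof.
  intros [Htr Htri]; split.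
  - intros x Hx z Hz; rewrite in_succ in *.
    destruct Hx as [Hx| ->]; [left; apply (Htr x); auto|auto].
  - intros x y Hx Hy; rewrite in_succ in *.
    destruct Hx as [Hx| ->], Hy as [Hy| ->]; auto.
Qed.

Lemma transitive_set_of_ordinals (a : M) :
  (forall x, x ∈ a -> is_ordinal x) -> (forall x, x ∈ a -> subset x a) ->
  is_ordinal a.
Proof.
  intros H Htr; split; [exact Htr|].
  intros x y Hx Hy; apply ordinal_comparable; auto.
Qed.

(** * Choice and well-orderings *)

(** The recursion clause of Zermelo's enumeration: the value of [h] at [b] is
    the element chosen by [g] among those of [V] not yet used before [b]. *)
Definition follows_choice (g V h b v : M) : Prop :=
  exists S, (forall x, x ∈ S <-> x ∈ V /\ ~ exists c, c ∈ b /\ maps h c x) /\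
    maps g S v.

(** An initial stretch, of length [a], of the enumeration of [V] along [g]. *)
Definition is_attempt (g V a h : M) : Prop :=
  is_ordinal a /\ is_function h a V /\
  forall b v, b ∈ a -> maps h b v -> follows_choice g V h b v.

Definition attempted (g V b v : M) : Prop :=
  exists a h, is_attempt g V a h /\ maps h b v.

(** At the least stage of disagreement both attempts have used the same elements
    before, and [g] chooses from the same set. *)
Lemma attempts_agree (g F B V : M) :
  is_function g F B ->
  forall a h a' h' b v v',
    is_attempt g V a h -> is_attempt g V a' h' ->
    maps h b v -> maps h' b v' -> v = v'.
Proof.
  intros Hg a h a' h' b v v' (Ha & Hh & Hrec) (Ha' & Hh' & Hrec') Hv Hv'.
  apply NNPP; intro Hne.
  destruct (minimal_element
    (fun b => exists v v', maps h b v /\ maps h' b v' /\ v <> v') a)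
    as (m & Hm & (u & u' & Hu & Hu' & Hneq) & Hmin).
  { definability. }
  { exists b; split; [apply (function_bounds h a V b v Hh Hv)|].
    exists v, v'; auto. }
  apply Hneq.
  assert (Hm' : m ∈ a') by apply (function_bounds h' a' V m u' Hh' Hu').
  assert (E : forall c x, c ∈ m -> maps h c x <-> maps h' c x).
  { intros c x Hc.
    assert (Hca : c ∈ a) by (apply (proj1 Ha m); auto).
    assert (Hca' : c ∈ a') by (apply (proj1 Ha' m); auto).
    destruct (function_value h a V c Hh Hca) as (y & _ & Hy).
    destruct (function_value h' a' V c Hh' Hca') as (y' & _ & Hy').
    assert (y = y').
    { apply NNPP; intro K; apply (Hmin c Hc Hca); exists y, y'; auto. }
    subst y'; split; intro Hx.
    - rewrite (function_unique h a V c x y Hh Hx Hy); exact Hy'.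
    - rewrite (function_unique h' a' V c x y Hh' Hx Hy'); exact Hy. }
  destruct (Hrec m u Hm Hu) as (S & HS & HgS).
  destruct (Hrec' m u' Hm' Hu') as (S' & HS' & HgS').
  assert (S = S').
  { apply set_ext; intro x; rewrite (HS x), (HS' x).
    split; intros [HxV Hx]; split; auto; intros (c & Hc & Hcx); apply Hx;
      exists c; split; auto; apply E; auto. }
  subst S'; apply (function_unique g F B S); auto.
Qed.

(** A value used at an earlier stage is not available at a later one. *)
Lemma attempted_injective (g F B V : M) :
  is_function g F B -> (forall S v, maps g S v -> v ∈ S) ->
  forall b c v, attempted g V b v -> attempted g V c v -> b = c.
Proof.
  intros Hg Hch.
  assert (K : forall b c v,
    attempted g V b v -> attempted g V c v -> b ∉ c).
  { intros b c v (a & h & Hat & Hv) (a' & h' & Hat' & Hv') Hbc.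
    pose proof Hat' as (Ha' & Hh' & Hrec').
    assert (Hc : c ∈ a') by apply (function_bounds h' a' V c v Hh' Hv').
    assert (Hb : b ∈ a') by (apply (proj1 Ha' c); auto).
    destruct (function_value h' a' V b Hh' Hb) as (u & _ & Hu).
    rewrite <- (attempts_agree g F B V Hg a h a' h' b v u Hat Hat' Hv Hu) in Hu.
    destruct (Hrec' c v Hc Hv') as (S & HS & HgS).
    apply Hch in HgS; apply HS in HgS; apply HgS; exists b; auto. }
  intros b c v Hb Hc.
  assert (O : forall d, attempted g V d v -> is_ordinal d).
  { intros d (a & h & (Ha & Hh & _) & Hv); apply (ordinal_element a); auto.
    apply (function_bounds h a V d v Hh Hv). }
  destruct (ordinal_comparable b c (O b Hb) (O c Hc)) as [H|[H|H]]; auto;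
    [destruct (K b c v Hb Hc H)|destruct (K c b v Hc Hb H)].
Qed.

(** Glueing all attempts gives an enumeration whose length is the set [t] of all
    stages reached; [t] is a set by Replacement, because stages are determined by
    their values.  If an element of [V] were missed, the enumeration could be
    prolonged by one step, and [t] itself would be a stage. *)
Lemma AC_injection_into_ordinal (V : M) :
  AC M -> exists a c : M, is_ordinal a /\ is_injection c V a.
Proof.
  intro HAC.
  destruct (ZF_power M HM V) as [PV HPV].
  destruct (separation (fun S => exists x, x ∈ S) PV) as [F HF]; [definability|].
  destruct (HAC F) as (g & B & Hg & Hch).
  { intros X HX; apply HF in HX; apply HX. }
  assert (Hdef : definable (fun e => attempted g V (e 0) (e 1))).
  { unfold attempted, is_attempt, follows_choice; definability. }
  assert (Hdef' : definable (fun e => attempted g V (e 1) (e 0))).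
  { unfold attempted, is_attempt, follows_choice; definability. }
  assert (Hfun : forall b v v', attempted g V b v -> attempted g V b v' -> v = v').
  { intros b v v' (a & h & Hat & Hv) (a' & h' & Hat' & Hv').
    exact (attempts_agree g F B V Hg a h a' h' b v v' Hat Hat' Hv Hv'). }
  pose proof (attempted_injective g F B V Hg Hch) as Hinj.
  destruct (replacement (fun v b => attempted g V b v) V Hdef') as [t Ht].
  { intros v b c _; apply Hinj. }
  assert (Hval : forall b, b ∈ t <-> exists v, v ∈ V /\ attempted g V b v) by exact Ht.
  assert (Hrange : forall b v, attempted g V b v -> b ∈ t /\ v ∈ V).
  { intros b v H; assert (v ∈ V).
    { destruct H as (a & h & (_ & Hh & _) & Hv).
      apply (function_bounds h a V b v Hh Hv). }
    split; auto; apply Hval; exists v; auto. }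
  assert (Hdown : forall a h b c v, is_attempt g V a h -> maps h b v -> c ∈ b ->
            forall x, maps h c x <-> attempted g V c x).
  { intros a h b c v Hat Hv Hc x; split; intro Hx; [exists a, h; auto|].
    pose proof Hat as (Ha & Hh & _).
    assert (Hca : c ∈ a).
    { apply (proj1 Ha b); auto; apply (function_bounds h a V b v Hh Hv). }
    destruct (function_value h a V c Hh Hca) as (y & _ & Hy).
    rewrite (Hfun c x y); auto; exists a, h; auto. }
  assert (Hord : is_ordinal t).
  { apply transitive_set_of_ordinals; intros b Hb; apply Hval in Hb;
      destruct Hb as (v & Hv & a & h & Hat & Hbv);
      pose proof Hat as (Ha & Hh & _);
      assert (Hba : b ∈ a) by apply (function_bounds h a V b v Hh Hbv).
    - apply (ordinal_element a); auto.
    - intros c Hc.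
      assert (Hca : c ∈ a) by (apply (proj1 Ha b); auto).
      destruct (function_value h a V c Hh Hca) as (y & Hy & Hcy).
      apply Hval; exists y; split; auto; exists a, h; auto. }
  assert (Hsurj : forall v, v ∈ V -> exists b, attempted g V b v).
  { intros v Hv; apply NNPP; intro Hno.
    destruct (separation (fun x => ~ exists b, attempted g V b x) V) as [S HS].
    { unfold attempted, is_attempt, follows_choice; definability. }
    assert (HSF : S ∈ F).
    { apply HF; split; [apply HPV; intros x Hx; apply HS in Hx; tauto|].
      exists v; apply HS; auto. }
    destruct (function_value g F B S Hg HSF) as (v0 & _ & Hv0).
    assert (HvS : v0 ∈ V) by (apply Hch, HS in Hv0; tauto).
    destruct (function_exists (succ t) V
      (fun b x => attempted g V b x \/ b = t /\ x = v0)) as (h & Hh & Hhm).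
    { unfold attempted, is_attempt, follows_choice; definability. }
    { intros b Hb; apply in_succ in Hb; destruct Hb as [Hb| ->].
      - apply Hval in Hb; destruct Hb as (x & Hx & Hbx); exists x; auto.
      - exists v0; auto. }
    { intros b x y _ [Hx|[-> ->]] [Hy|[E ->]].
      - apply (Hfun b); auto.
      - subst; destruct (mem_irrefl t); apply (Hrange t x); auto.
      - destruct (mem_irrefl t); apply (Hrange t y); auto.
      - reflexivity. }
    assert (Hht : forall c x, c ∈ t -> maps h c x <-> attempted g V c x).
    { intros c x Hc; rewrite Hhm; split.
      - intros (_ & _ & [H|[-> _]]); auto; destruct (mem_irrefl _ Hc).
      - intro H; repeat split; [|apply (Hrange c x H)|auto].
        apply in_succ; auto. }
    assert (Hnew : is_attempt g V (succ t) h).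
    { split; [apply ordinal_succ, Hord|split; [exact Hh|]].
      intros b x _ Hbx; apply Hhm in Hbx; destruct Hbx as (_ & _ & [Hbx|[-> ->]]).
      - pose proof Hbx as (a & k & Hat & Hk).
        pose proof Hat as (Ha & Hkf & Hrec).
        destruct (Hrec b x (proj1 (function_bounds k a V b x Hkf Hk)) Hk)
          as (T & HT & HgT).
        exists T; split; auto.
        intro y; rewrite (HT y).
        assert (E : forall c, c ∈ b -> maps k c y <-> maps h c y).
        { intros c Hc; rewrite (Hdown a k b c x Hat Hk Hc), Hht; [tauto|].
          apply (proj1 Hord b); auto; apply (Hrange b x Hbx). }
        split; intros [HyV Hy]; split; auto; intros (c & Hc & Hcy); apply Hy;
          exists c; split; auto; apply E; auto.
      - exists S; split; auto.
        intro y; rewrite (HS y).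
        split; intros [HyV Hy]; split; auto.
        + intros (c & Hc & Hcy); apply Hy; exists c; apply Hht; auto.
        + intros (c & Hcy); apply Hy; exists c.
          assert (c ∈ t) by apply (Hrange c y Hcy).
          split; auto; apply Hht; auto. }
    apply (mem_irrefl t), (Hrange t v0); exists (succ t), h; split; auto.
    apply Hhm; rewrite in_succ; auto. }
  destruct (function_exists V t (fun v b => attempted g V b v) Hdef')
    as (c & Hc & Hcm).
  { intros v Hv; destruct (Hsurj v Hv) as [b Hb]; exists b; split; auto.
    apply (Hrange b v Hb). }
  { intros v b b' _; apply Hinj. }
  exists t, c; split; auto; split; auto.
  intros v v' b Hv Hv'; apply Hcm in Hv, Hv'; apply (Hfun b); tauto.
Qed.

(** The least ordinal into which [V] injects is a cardinal: a bijection with a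
    smaller ordinal could be composed with the injection. *)
Lemma AC_injection_into_cardinal (V : M) :
  AC M -> exists K c : M, is_cardinal K /\ is_injection c V K.
Proof.
  intro HAC; destruct (AC_injection_into_ordinal V HAC) as (a & c & Ha & Hc).
  assert (Hsa : is_ordinal (succ a)) by (apply ordinal_succ, Ha).
  destruct (minimal_element (fun b => exists c, is_injection c V b) (succ a))
    as (K & HK & [k Hk] & Hmin).
  { definability. }
  { exists a; rewrite in_succ; split; [auto|exists c; exact Hc]. }
  exists K, k; split; [split|exact Hk].
  - apply (ordinal_element (succ a)); auto.
  - intros b Hb HbK [h [[Hh Hhinj] Hhsurj]].
    apply (Hmin b HbK); [apply (proj1 Hsa K); auto|].
    destruct Hk as [Hk Hkinj].
    destruct (function_exists V b (fun v x => exists y, maps k v y /\ maps h x y))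
      as (d & Hd & Hdm).
    { definability. }
    { intros v Hv; destruct (function_value k V K v Hk Hv) as (y & Hy & Hvy).
      destruct (Hhsurj y Hy) as [x Hx]; exists x; split; [|exists y; auto].
      apply (function_bounds h b K x y Hh Hx). }
    { intros v x x' _ (y & Hy & Hx) (y' & Hy' & Hx').
      rewrite <- (function_unique k V K v y y' Hk Hy Hy') in Hx'.
      apply (Hhinj x x' y); auto. }
    exists d; split; auto.
    intros v v' x Hv Hv'; apply Hdm in Hv, Hv'.
    destruct Hv as (_ & _ & y & Hy & Hxy), Hv' as (_ & _ & y' & Hy' & Hxy').
    rewrite <- (function_unique h b K x y y' Hh Hxy Hxy') in Hy'.
    apply (Hkinj v v' y); auto.
Qed.

(** A single labelling of the union of the family suffices: from each set, choose
    the element with the least label. *)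
Lemma AC_of_injections_into_ordinals :
  (forall X : M, (exists x, x ∈ X) ->
     exists K d : M, is_ordinal K /\ is_injection d X K) ->
  AC M.
Proof.
  intros H F HF.
  destruct (ZF_union M HM F) as [U HU].
  (* The union [U] may be empty, so [U] itself is added as one more element. *)
  destruct (H (succ U)) as (K & d & HK & Hd & Hinj).
  { exists U; rewrite in_succ; auto. }
  assert (Hmem : forall X x, X ∈ F -> x ∈ X -> x ∈ succ U).
  { intros X x HX Hx; rewrite in_succ, (HU x); left; exists X; auto. }
  destruct (function_exists F U (fun X x => x ∈ X /\
      exists k, maps d x k /\ forall y l, y ∈ X -> maps d y l -> l ∉ k))
    as (f & Hf & Hfm).
  - definability.
  - intros X HX.
    destruct (minimal_element (fun k => exists x, x ∈ X /\ maps d x k) K)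
      as (k & Hk & (x & Hx & Hxk) & Hmin).
    { definability. }
    { destruct (HF X HX) as [x Hx].
      destruct (function_value d (succ U) K x Hd (Hmem X x HX Hx)) as (k & Hk & Hxk).
      exists k; split; auto; exists x; auto. }
    exists x; split; [apply HU; exists X; auto|split; auto].
    exists k; split; auto.
    intros y l Hy Hl Hlk; apply (Hmin l Hlk); [|exists y; auto].
    apply (function_bounds d (succ U) K y l Hd Hl).
  - intros X x y _ (Hx & k & Hk & Hxmin) (Hy & l & Hl & Hymin).
    assert (k = l).
    { destruct (proj2 HK k l) as [E|[E|E]]; auto.
      - apply (function_bounds d (succ U) K x k Hd Hk).
      - apply (function_bounds d (succ U) K y l Hd Hl).
      - destruct (Hymin x k Hx Hk E).
      - destruct (Hxmin y l Hy Hl E). }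
    subst l; apply (Hinj x y k); auto.
  - exists f, U; split; auto.
    intros X x Hx; apply Hfm in Hx; tauto.
Qed.

(** * Natural numbers *)

Lemma inductive_eq (I : M) :
  is_inductive I <-> empty ∈ I /\ forall n, n ∈ I -> succ n ∈ I.
Proof.
  split.
  - intros [(o & Ho & HoI) Hs]; apply is_empty_eq in Ho; subst o; split; auto.
    intros n Hn; destruct (Hs n Hn) as (s & Hsn & HsI).
    apply is_succ_eq in Hsn; subst; auto.
  - intros [H0 Hs]; split.
    + exists empty; split; auto; apply is_empty_eq; auto.
    + intros n Hn; exists (succ n); split; auto; apply is_succ_eq; auto.
Qed.

(** The elements common to all inductive sets, cut out of one of them. *)
Lemma omega_exists : exists w : M, is_omega w.
Proof.
  destruct (ZF_infinity M HM) as [I HI].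
  destruct (separation (fun n => forall J, is_inductive J -> n ∈ J) I) as [w Hw].
  { definability. }
  exists w; split.
  - apply inductive_eq; split.
    + apply Hw; split; [|intros J HJ]; apply inductive_eq; auto.
    + intros n Hn; apply Hw in Hn; destruct Hn as [Hn HJn].
      apply Hw; split; [|intros J HJ; specialize (HJn J HJ)];
        apply inductive_eq; auto.
  - intros J HJ n Hn; apply Hw in Hn; apply Hn, HJ.
Qed.

Lemma omega_empty (w : M) : is_omega w -> empty ∈ w.
Proof. intros [H _]; apply inductive_eq in H; tauto. Qed.

Lemma omega_succ (w n : M) : is_omega w -> n ∈ w -> succ n ∈ w.
Proof. intros [H _] Hn; apply inductive_eq in H; apply H, Hn. Qed.

Lemma omega_induction (w : M) (P : M -> Prop) :
  is_omega w -> definable (fun e => P (e 0)) ->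
  P empty -> (forall n, n ∈ w -> P n -> P (succ n)) ->
  forall n, n ∈ w -> P n.
Proof.
  intros Hw HP H0 HS n Hn.
  destruct (separation P w HP) as [I HI].
  assert (K : is_inductive I).
  { apply inductive_eq; split.
    - apply HI; split; auto; apply omega_empty, Hw.
    - intros m Hm; apply HI in Hm; apply HI; split; [|apply HS; tauto].
      apply omega_succ; tauto. }
  apply (proj2 Hw I K) in Hn; apply HI in Hn; tauto.
Qed.

Lemma omega_ordinal (w n : M) : is_omega w -> n ∈ w -> is_ordinal n.
Proof.
  intros Hw; apply (omega_induction w is_ordinal Hw).
  - definability.
  - split; [intros x Hx|intros x y Hx]; destruct (not_in_empty x Hx).
  - intros m _; apply ordinal_succ.
Qed.

(** * Every set is a member of an acceptable family, up to bijection *)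

Definition family_setting (w A z z' V : M) : Prop :=
  is_omega w /\ is_acceptable w A /\ is_auxiliary w A z z' /\
  is_family_vertex_set A z z' V.

(** The family is [A_i = X × {i}], with [z_i = (X, i)] and [z'_i = ({X}, i)].  By
    Foundation, [X] and [{X}] are distinct and neither is an element of [X], so
    the first coordinates alone keep the three kinds of vertices apart. *)
Lemma copies_family (X : M) :
  (exists x, x ∈ X) ->
  exists w A z z' V i S, family_setting w A z z' V /\
    maps A i S /\ forall p, p ∈ S <-> exists x, x ∈ X /\ p = opair x i.
Proof.
  intros [x0 Hx0].
  destruct omega_exists as [w Hw].
  (* The first coordinates of the [z_i] and of the [z'_i]. *)
  set (t := X); set (t' := upair X X).
  set (T := cup X (upair t t')).
  assert (HtX : t ∉ X) by apply mem_irrefl.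
  assert (Ht't : t' <> t).
  { intro E; apply (mem_irrefl X); unfold t' in E; fold t; rewrite <- E at 2.
    apply in_upair; auto. }
  assert (Ht'X : t' ∉ X).
  { intro H; apply (mem_asym X t'); auto; apply in_upair; auto. }
  assert (HTt : t ∈ T) by (apply in_cup; rewrite in_upair; auto).
  assert (HTt' : t' ∈ T) by (apply in_cup; rewrite in_upair; auto).
  assert (HTX : forall x, x ∈ X -> x ∈ T) by (intros; apply in_cup; auto).
  destruct (product_exists T w) as [V HV].
  destruct (ZF_power M HM V) as [PV HPV].
  assert (Hcopy : forall i, i ∈ w -> exists S, S ∈ PV /\
    forall p, p ∈ S <-> exists x, x ∈ X /\ is_opair p x i).
  { intros i Hi.
    destruct (separation (fun p => exists x, x ∈ X /\ is_opair p x i) V)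
      as [S HS]; [definability|].
    assert (HS' : forall p, p ∈ S <-> exists x, x ∈ X /\ is_opair p x i).
    { intro p; rewrite (HS p); split; [tauto|]; intro H; split; auto.
      destruct H as (x & Hx & Hp); apply HV; exists x, i.
      rewrite <- is_opair_eq; auto. }
    exists S; split; auto; apply HPV; intros p Hp; apply HS in Hp; tauto. }
  destruct (function_exists w PV
    (fun i S => forall p, p ∈ S <-> exists x, x ∈ X /\ is_opair p x i))
    as (A & HA & HAm).
  { definability. }
  { exact Hcopy. }
  { intros i S S' _ HS HS'; apply set_ext; intro p; rewrite (HS p), (HS' p); tauto. }
  assert (Htag : forall s, s ∈ T -> exists z, is_injection z w V /\
    forall i p, maps z i p <-> i ∈ w /\ p = opair s i).
  { intros s Hs.
    destruct (function_exists w V (fun i p => is_opair p s i)) as (z & Hz & Hzm).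
    { definability. }
    { intros i Hi; exists (opair s i); rewrite is_opair_eq; split; auto.
      apply HV; exists s, i; auto. }
    { intros i p q _ Hp Hq; apply is_opair_eq in Hp, Hq; congruence. }
    exists z; split; [split; [exact Hz|]|].
    - intros i j p Hi Hj; apply Hzm in Hi, Hj; rewrite is_opair_eq in Hi, Hj.
      destruct Hi as (_ & _ & Hi), Hj as (_ & _ & Hj).
      rewrite Hi in Hj; apply opair_inj in Hj; tauto.
    - intros i p; rewrite Hzm, is_opair_eq; split; [tauto|].
      intros [Hi ->]; repeat split; auto; apply HV; exists s, i; auto. }
  destruct (Htag t HTt) as (z & Hz & Hzm).
  destruct (Htag t' HTt') as (z' & Hz' & Hzm').
  assert (HSm : forall i S p, maps A i S ->
    p ∈ S <-> exists x, x ∈ X /\ p = opair x i).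
  { intros i S p H; apply HAm in H; destruct H as (_ & _ & H); rewrite (H p).
    split; intros (x & Hx & Hp); exists x; split; auto;
      apply is_opair_eq; exact Hp. }
  destruct (Hcopy empty (omega_empty w Hw)) as (S0 & HS0 & HS0m).
  assert (HAS0 : maps A empty S0).
  { apply HAm; repeat split; auto; [apply omega_empty, Hw| |]; apply HS0m. }
  exists w, A, z, z', V, empty, S0; split; [|split; [exact HAS0|]].
  2: { intro p; apply (HSm empty S0 p HAS0). }
  split; [exact Hw|split; [|split]].
  - split; [exists PV; exact HA|split].
    + intros i S HS; exists (opair x0 i); apply (HSm i S _ HS); exists x0; auto.
    + intros i j S S' HS HS' Hij p [Hp Hp'].
      apply (HSm i S p HS) in Hp; apply (HSm j S' p HS') in Hp'.
      destruct Hp as (x & _ & ->), Hp' as (y & _ & E).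
      apply opair_inj in E; tauto.
  - split; [exists V; exact Hz|split; [exists V; exact Hz'|split]].
    + intros i j p [Hp Hp']; apply Hzm in Hp; apply Hzm' in Hp'.
      destruct Hp as [_ ->], Hp' as [_ E]; apply opair_inj in E.
      apply Ht't; symmetry; tauto.
    + intros i j S p HS Hp; apply (HSm i S p HS) in Hp.
      destruct Hp as (x & Hx & ->); split; intro H;
        [apply Hzm in H|apply Hzm' in H]; destruct H as [_ E];
        apply opair_inj in E; destruct E; subst x; contradiction.
  - intro p; rewrite (HV p); split.
    + intros (s & i & Hs & Hi & ->); apply in_cup in Hs; rewrite in_upair in Hs.
      destruct Hs as [Hs|[-> | ->]].
      * left; destruct (function_value A w PV i HA Hi) as (S & _ & HS).
        exists i, S; split; auto; apply (HSm i S _ HS); exists s; auto.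
      * right; left; exists i; apply Hzm; auto.
      * right; right; exists i; apply Hzm'; auto.
    + intros [(i & S & HS & Hp)|[[i Hi]|[i Hi]]].
      * assert (i ∈ w) by apply (function_bounds A w PV i S HA HS).
        apply (HSm i S p HS) in Hp; destruct Hp as (x & Hx & ->).
        exists x, i; auto.
      * apply Hzm in Hi; destruct Hi as [Hi ->]; exists t, i; auto.
      * apply Hzm' in Hi; destruct Hi as [Hi ->]; exists t', i; auto.
Qed.

Lemma AC_of_family_members_injecting :
  (forall w A z z' V i S : M, family_setting w A z z' V -> maps A i S ->
     exists K d : M, is_ordinal K /\ is_injection d S K) ->
  AC M.
Proof.
  intro H; apply AC_of_injections_into_ordinals; intros X HX.
  destruct (copies_family X HX) as (w & A & z & z' & V & i & S & Hset & HS & HSm).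
  destruct (H w A z z' V i S Hset HS) as (K & d & HK & Hd & Hinj).
  assert (Hin : forall x, x ∈ X -> opair x i ∈ S).
  { intros x Hx; apply HSm; exists x; auto. }
  destruct (function_exists X K (fun x k => exists p, is_opair p x i /\ maps d p k))
    as (c & Hc & Hcm).
  - definability.
  - intros x Hx; destruct (function_value d S K _ Hd (Hin x Hx)) as (k & Hk & Hm).
    exists k; split; auto; exists (opair x i); rewrite is_opair_eq; auto.
  - intros x k l _ (p & Hp & Hk) (q & Hq & Hl).
    apply is_opair_eq in Hp, Hq; subst.
    apply (function_unique d S K (opair x i)); auto.
  - exists K, c; split; auto; split; auto.
    intros x y k Hx Hy; apply Hcm in Hx, Hy.
    destruct Hx as (_ & _ & p & Hp & Hk), Hy as (_ & _ & q & Hq & Hl).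
    apply is_opair_eq in Hp, Hq; subst.
    pose proof (Hinj _ _ _ Hk Hl) as E; apply opair_inj in E; tauto.
Qed.

(** * The graphs of an acceptable family *)

Lemma adjacent_sym (E x y : M) : adjacent E x y -> adjacent E y x.
Proof. intros (e & He & H); exists e; split; auto; apply is_upair_sym, H. Qed.

Lemma graph_adjacent (V E x y : M) :
  is_graph V E -> adjacent E x y -> x ∈ V /\ y ∈ V /\ x <> y.
Proof.
  intros HG (e & He & H); destruct (HG e He) as (a & b & Ha & Hb & Hab & H').
  destruct (is_upair_cases e x y a b H H') as [[-> ->]|[-> ->]]; auto.
Qed.

Lemma graph_on_edges (V : M) (P : M -> Prop) :
  definable (fun e => P (e 0)) ->
  (forall e, P e -> exists x y, x ∈ V /\ y ∈ V /\ x <> y /\ is_upair e x y) ->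
  exists E, is_graph V E /\ forall e, e ∈ E <-> P e.
Proof.
  intros HP HV; destruct (ZF_power M HM V) as [PV HPV].
  destruct (separation P PV HP) as [E HE].
  assert (HE' : forall e, e ∈ E <-> P e).
  { intro e; rewrite (HE e); split; [tauto|]; intro He; split; auto.
    destruct (HV e He) as (x & y & Hx & Hy & _ & Hxy).
    apply HPV; intros u Hu; apply Hxy in Hu; destruct Hu; subst; auto. }
  exists E; split; auto; intros e He; apply HV, HE', He.
Qed.

Section Family.

Context {w A z z' V : M} (Hset : family_setting w A z z' V).

Lemma vertex_of_member (i S a : M) : maps A i S -> a ∈ S -> a ∈ V.
Proof. intros HS Ha; apply Hset; left; exists i, S; auto. Qed.

Lemma vertex_of_z (i a : M) : maps z i a -> a ∈ V.
Proof. intro H; apply Hset; right; left; exists i; auto. Qed.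

Lemma vertex_of_z' (i a : M) : maps z' i a -> a ∈ V.
Proof. intro H; apply Hset; right; right; exists i; auto. Qed.

Lemma z_z'_distinct (i j a b : M) : maps z i a -> maps z' j b -> a <> b.
Proof.
  destruct Hset as (_ & _ & (_ & _ & H & _) & _).
  intros Ha Hb ->; apply (H i j b); auto.
Qed.

Lemma member_not_z (i j S a : M) : maps A i S -> a ∈ S -> ~ maps z j a.
Proof.
  destruct Hset as (_ & _ & (_ & _ & _ & H) & _).
  intros HS Ha; apply (H i j S a HS Ha).
Qed.

Lemma member_not_z' (i j S a : M) : maps A i S -> a ∈ S -> ~ maps z' j a.
Proof.
  destruct Hset as (_ & _ & (_ & _ & _ & H) & _).
  intros HS Ha; apply (H i j S a HS Ha).
Qed.

Lemma z'_unique (i a b : M) : maps z' i a -> maps z' i b -> a = b.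
Proof.
  destruct Hset as (_ & _ & (_ & (Z' & H & _) & _) & _).
  apply (function_unique z' w Z' i a b H).
Qed.

Lemma z_value (i : M) : i ∈ w -> exists a, maps z i a.
Proof.
  destruct Hset as (_ & _ & ((Z & H & _) & _) & _).
  intro Hi; destruct (function_value z w Z i H Hi) as (a & _ & Ha); exists a; auto.
Qed.

Lemma z'_value (i : M) : i ∈ w -> exists a, maps z' i a.
Proof.
  destruct Hset as (_ & _ & (_ & (Z' & H & _) & _) & _).
  intro Hi; destruct (function_value z' w Z' i H Hi) as (a & _ & Ha); exists a; auto.
Qed.

Lemma z_index (i a : M) : maps z i a -> i ∈ w.
Proof.
  destruct Hset as (_ & _ & ((Z & H & _) & _) & _); apply (function_bounds z w Z i a H).
Qed.

Lemma z'_index (i a : M) : maps z' i a -> i ∈ w.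
Proof.
  destruct Hset as (_ & _ & (_ & (Z' & H & _) & _) & _).
  apply (function_bounds z' w Z' i a H).
Qed.

Lemma member_index (i S : M) : maps A i S -> i ∈ w.
Proof.
  destruct Hset as (_ & ((B & H) & _) & _); apply (function_bounds A w B i S H).
Qed.

Lemma z_consecutive_distinct (i a b : M) :
  maps z i a -> maps z (succ i) b -> a <> b.
Proof.
  destruct Hset as (_ & _ & ((Z & _ & Hinj) & _) & _).
  intros Ha Hb ->; apply (mem_irrefl i); rewrite (Hinj i (succ i) b Ha Hb) at 2.
  apply in_succ; auto.
Qed.

Lemma member_index_unique (i j S T a : M) :
  maps A i S -> maps A j T -> a ∈ S -> a ∈ T -> i = j.
Proof.
  destruct Hset as (_ & (_ & _ & Hdisj) & _).
  intros HS HT HaS HaT; apply NNPP; intro Hij.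
  apply (Hdisj i j S T HS HT Hij a); auto.
Qed.

Lemma edge_of_G_proper (e : M) :
  is_edge_of_G A z z' e ->
  exists x y, x ∈ V /\ y ∈ V /\ x <> y /\ is_upair e x y.
Proof.
  intros [(i & j & a & b & Hj & Ha & Hb & He)|
          [(i & a & b & Ha & Hb & He)|(i & S & a & b & HS & Ha & Hb & He)]];
    exists a, b; repeat split; try apply He; auto.
  - apply (vertex_of_z i a Ha).
  - apply (vertex_of_z j b Hb).
  - apply is_succ_eq in Hj; subst j; apply (z_consecutive_distinct i a b Ha Hb).
  - apply (vertex_of_z i a Ha).
  - apply (vertex_of_z' i b Hb).
  - apply (z_z'_distinct i i a b Ha Hb).
  - apply (vertex_of_member i S a HS Ha).
  - apply (vertex_of_z' i b Hb).
  - intros ->; apply (member_not_z' i i S b HS Ha Hb).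
Qed.

Lemma clique_edge_proper (e : M) :
  is_clique_edge A e ->
  exists x y, x ∈ V /\ y ∈ V /\ x <> y /\ is_upair e x y.
Proof.
  intros (i & S & a & b & HS & Ha & Hb & Hab & He).
  exists a, b; split; [|split; [|split]]; auto; apply (vertex_of_member i S); auto.
Qed.

Lemma graph_G_is_graph (E : M) : is_graph_G A z z' V E -> is_graph V E.
Proof. intros [_ HE] e He; apply edge_of_G_proper, HE, He. Qed.

Lemma graph_H_is_graph (E : M) : is_graph_H A z z' V E -> is_graph V E.
Proof.
  intros [_ HE] e He; apply HE in He; destruct He;
    [apply edge_of_G_proper|apply clique_edge_proper]; auto.
Qed.

Lemma graph_G_exists : exists E, is_graph_G A z z' V E.
Proof.
  destruct (graph_on_edges V (is_edge_of_G A z z')) as (E & _ & HE).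
  - definability.
  - exact edge_of_G_proper.
  - exists E; split; auto; apply Hset.
Qed.

Lemma graph_H_exists : exists E, is_graph_H A z z' V E.
Proof.
  destruct (graph_on_edges V
    (fun e => is_edge_of_G A z z' e \/ is_clique_edge A e)) as (E & _ & HE).
  - definability.
  - intros e [He|He]; [apply edge_of_G_proper|apply clique_edge_proper]; auto.
  - exists E; split; auto; apply Hset.
Qed.

Lemma member_edge_in_G (i S a e b : M) :
  maps A i S -> a ∈ S -> maps z' i b -> is_upair e a b ->
  is_edge_of_G A z z' e.
Proof. intros HS Ha Hb He; right; right; exists i, S, a, b; auto. Qed.

(** The sets [A_i], Z and Z' are disjoint, so [a] occurs only in edges of the third
    kind, and only for its own index. *)
Lemma neighbour_of_member (i S a e v : M) :
  maps A i S -> a ∈ S -> is_edge_of_G A z z' e -> is_upair e a v -> maps z' i v.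
Proof.
  intros HS Ha HE He.
  destruct HE as [(k & l & p & q & Hl & Hp & Hq & He')|
    [(k & p & q & Hp & Hq & He')|(k & T & p & q & HT & Hp & Hq & He')]];
    destruct (is_upair_cases e a v p q He He') as [[<- <-]|[<- <-]].
  - destruct (member_not_z i k S a HS Ha Hp).
  - destruct (member_not_z i l S a HS Ha Hq).
  - destruct (member_not_z i k S a HS Ha Hp).
  - destruct (member_not_z' i k S a HS Ha Hq).
  - rewrite (member_index_unique i k S T a HS HT Ha Hp); exact Hq.
  - destruct (member_not_z' i k S a HS Ha Hq).
Qed.

Lemma members_are_twins (E i S a b : M) :
  is_graph_G A z z' V E -> maps A i S -> a ∈ S -> b ∈ S ->
  forall v, adjacent E a v <-> adjacent E b v.
Proof.
  intros [_ HE] HS.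
  assert (K : forall a b, a ∈ S -> b ∈ S ->
    forall v, adjacent E a v -> adjacent E b v).
  { intros p q Hp Hq v (e & He & Hev); apply HE in He.
    pose proof (neighbour_of_member i S p e v HS Hp He Hev) as Hv.
    exists (upair q v); rewrite is_upair_eq; split; auto.
    apply HE; apply (member_edge_in_G i S q _ v); auto; apply is_upair_eq; auto. }
  intros Ha Hb v; split; apply K; auto.
Qed.

End Family.

(** * From colourings to choice *)

Definition swaps (f a b V : M) : Prop :=
  forall x y, maps f x y <-> x ∈ V /\
    (x = a /\ y = b \/ x = b /\ y = a \/ x <> a /\ x <> b /\ y = x).

(** Two twins are not adjacent, since the graph has no loops; so exchanging them
    preserves every edge. *)
Lemma twins_swap (V E a b : M) :
  is_graph V E -> a ∈ V -> b ∈ V ->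
  (forall v, adjacent E a v <-> adjacent E b v) ->
  exists f, is_automorphism f V E /\ swaps f a b V.
Proof.
  intros HG Ha Hb Htw.
  destruct (function_exists V V (fun x y =>
    x = a /\ y = b \/ x = b /\ y = a \/ x <> a /\ x <> b /\ y = x))
    as (f & Hf & Hfm0).
  { definability. }
  { intros x Hx; destruct (classic (x = a)) as [->|Hxa]; [exists b; auto|].
    destruct (classic (x = b)) as [->|Hxb]; [exists a; auto|].
    exists x; auto 6. }
  { intros x y y' _; intuition congruence. }
  assert (Hfm : swaps f a b V).
  { intros x y; rewrite Hfm0; split; [tauto|]; intros [Hx Hxy]; repeat split; auto.
    destruct Hxy as [[_ ->]|[[_ ->]|(_ & _ & ->)]]; auto. }
  exists f; split; auto; split; [split; [split|]|]; auto.
  - intros x x' y Hx Hx'; apply Hfm in Hx, Hx'.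
    destruct Hx as [_ [[-> ->]|[[-> ->]|(? & ? & ->)]]];
      destruct Hx' as [_ [[? ?]|[[? ?]|(? & ? & ?)]]]; congruence.
  - intros y Hy; destruct (classic (y = a)) as [->|Hya].
    { exists b; apply Hfm; auto. }
    destruct (classic (y = b)) as [->|Hyb].
    { exists a; apply Hfm; auto. }
    exists y; apply Hfm; auto 6.
  - assert (Hsym : forall x y, adjacent E x y <-> adjacent E y x).
    { intros; split; apply adjacent_sym. }
    assert (Hirr : forall x, ~ adjacent E x x).
    { intros x H; apply (graph_adjacent V E x x HG) in H; tauto. }
    assert (Hab : ~ adjacent E a b).
    { intro H; apply (Hirr b), Htw, H. }
    assert (Htw' : forall v, adjacent E v a <-> adjacent E v b).
    { intro v; rewrite (Hsym v a), (Hsym v b); apply Htw. }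
    assert (Hba : ~ adjacent E b a) by (rewrite Hsym; exact Hab).
    intros x y x' y' Hx Hy; apply Hfm in Hx, Hy.
    destruct Hx as [_ [[-> ->]|[[-> ->]|(_ & _ & ->)]]];
      destruct Hy as [_ [[-> ->]|[[-> ->]|(_ & _ & ->)]]];
      pose proof (Hirr a); pose proof (Hirr b);
      try tauto; try apply Htw; try apply Htw'; symmetry;
      try apply Htw; apply Htw'.
Qed.

Lemma injection_from_labels (S K : M) (Q : M -> M -> Prop) :
  definable (fun e => Q (e 0) (e 1)) ->
  (forall a, a ∈ S -> exists k, k ∈ K /\ Q a k) ->
  (forall a k l, a ∈ S -> Q a k -> Q a l -> k = l) ->
  (forall a b k, a ∈ S -> b ∈ S -> Q a k -> Q b k -> a = b) ->
  exists d, is_injection d S K.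
Proof.
  intros HQ Htot Hfun Hinj.
  destruct (function_exists S K Q HQ Htot Hfun) as (d & Hd & Hdm).
  exists d; split; auto; intros a b k Ha Hb; apply Hdm in Ha, Hb.
  apply (Hinj a b k); tauto.
Qed.

(** If two members of [A_i] had the same colour, exchanging them would be a
    non-trivial automorphism preserving the colouring. *)
Lemma AC5_implies_AC : AC5 M -> AC M.
Proof.
  intro H; apply AC_of_family_members_injecting.
  intros w A z z' V i S Hset HS.
  destruct (graph_G_exists Hset) as [E HE].
  destruct (H w A z z' V E) as (K & c & HK & Hc & Hdist); try apply Hset; auto.
  assert (HSV : forall a, a ∈ S -> a ∈ V) by (intro a; apply (vertex_of_member Hset i S a HS)).
  destruct (injection_from_labels S K (fun a k => maps c a k)) as [d Hd].
  - definability.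
  - intros a Ha; apply (function_value c V K a Hc (HSV a Ha)).
  - intros a k l _; apply (function_unique c V K a k l Hc).
  - intros a b k Ha Hb Hak Hbk; apply NNPP; intro Hab.
    destruct (twins_swap V E a b) as (f & Hf & Hfm); auto.
    { apply (graph_G_is_graph Hset E HE). }
    { apply (members_are_twins Hset E i S a b HE HS Ha Hb). }
    assert (Hid : maps f a a).
    { apply (Hdist f Hf); auto.
      intros x y l Hxy Hl; apply Hfm in Hxy.
      destruct Hxy as [_ [[-> ->]|[[-> ->]|(_ & _ & ->)]]]; auto.
      - rewrite (function_unique c V K a l k Hc Hl Hak); auto.
      - rewrite (function_unique c V K b l k Hc Hl Hbk); auto. }
    apply Hfm in Hid; tauto.
  - exists K, d; split; auto; apply HK.
Qed.

(** The members of [A_i] form a clique in H_A. *)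
Lemma AC8_implies_AC : AC8 M -> AC M.
Proof.
  intro H; apply AC_of_family_members_injecting.
  intros w A z z' V i S Hset HS.
  destruct (graph_H_exists Hset) as [E HE].
  destruct (H w A z z' V E) as (K & c & HK & Hc & Hprop); try apply Hset; auto.
  assert (HSV : forall a, a ∈ S -> a ∈ V) by (intro a; apply (vertex_of_member Hset i S a HS)).
  destruct (injection_from_labels S K (fun a k => maps c a k)) as [d Hd].
  - definability.
  - intros a Ha; apply (function_value c V K a Hc (HSV a Ha)).
  - intros a k l _; apply (function_unique c V K a k l Hc).
  - intros a b k Ha Hb Hak Hbk; apply NNPP; intro Hab.
    apply (Hprop a b k k); auto.
    exists (upair a b); rewrite is_upair_eq; split; auto.
    apply HE; right; exists i, S, a, b; rewrite is_upair_eq; auto.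
  - exists K, d; split; auto; apply HK.
Qed.

(** Labelling a member [a] of [S = A_i] by the colour of its only edge, the
    one to [z'_i], reduces the edge colourings to the single injectivity
    condition in the hypothesis. *)
Lemma injection_from_pendant_edges (w A z z' V E i S K c : M) :
  family_setting w A z z' V -> is_graph_G A z z' V E -> maps A i S ->
  is_function c E K ->
  (forall a b v e e' k, a ∈ S -> b ∈ S -> maps z' i v ->
     is_upair e a v -> is_upair e' b v -> maps c e k -> maps c e' k -> a = b) ->
  exists d, is_injection d S K.
Proof.
  intros Hset HE HS Hc Hinj.
  destruct (z'_value Hset i (member_index Hset i S HS)) as [v Hv].
  apply (injection_from_labels S K (fun a k => exists e, is_upair e a v /\ maps c e k)).
  - definability.
  - intros a Ha; destruct (function_value c E K (upair a v) Hc) as (k & Hk & Hm).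
    { apply HE; apply (member_edge_in_G i S a _ v); auto; apply is_upair_eq; auto. }
    exists k; split; auto; exists (upair a v); rewrite is_upair_eq; auto.
  - intros a k l _ (e & He & Hk) (e' & He' & Hl).
    apply is_upair_eq in He, He'; subst.
    apply (function_unique c E K (upair a v)); auto.
  - intros a b k Ha Hb (e & He & Hk) (e' & He' & Hl).
    apply (Hinj a b v e e' k); auto.
Qed.

(** The edges from [A_i] to [z'_i] meet at [z'_i]. *)
Lemma AC7_implies_AC : AC7 M -> AC M.
Proof.
  intro H; apply AC_of_family_members_injecting.
  intros w A z z' V i S Hset HS.
  destruct (graph_G_exists Hset) as [E HE].
  destruct (H w A z z' V E) as (K & c & HK & Hc & Hprop); try apply Hset; auto.
  destruct (injection_from_pendant_edges w A z z' V E i S K c) as [d Hd]; auto.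
  - intros a b v e e' k Ha Hb Hv He He' Hk Hk'.
    apply NNPP; intro Hab; apply (Hprop e e' k k); auto.
    + apply (function_bounds c E K e k Hc Hk).
    + apply (function_bounds c E K e' k Hc Hk').
    + intros <-; destruct (is_upair_cases e a v b v He He') as [[? _]|[-> <-]]; auto.
    + exists v; split; [apply He|apply He']; auto.
  - exists K, d; split; auto; apply HK.
Qed.

(** Exchanging two members of [A_i] exchanges their edges to [z'_i] and fixes all
    other edges, so these two edges cannot have the same colour. *)
Lemma AC6_implies_AC : AC6 M -> AC M.
Proof.
  intro H; apply AC_of_family_members_injecting.
  intros w A z z' V i S Hset HS.
  destruct (graph_G_exists Hset) as [E HE].
  destruct (H w A z z' V E) as (K & c & HK & Hc & Hdist); try apply Hset; auto.
  assert (HSV : forall a, a ∈ S -> a ∈ V) by (intro a; apply (vertex_of_member Hset i S a HS)).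
  assert (HG : is_graph V E) by apply (graph_G_is_graph Hset E HE).
  destruct (injection_from_pendant_edges w A z z' V E i S K c) as [d Hd]; auto.
  - intros a b v e1 e2 k Ha Hb Hv He1 He2 Hk1 Hk2; apply NNPP; intro Hab.
    destruct (twins_swap V E a b) as (f & Hf & Hfm); auto.
    { apply (members_are_twins Hset E i S a b HE HS Ha Hb). }
    assert (Hva : v <> a).
    { intros ->; apply (member_not_z' Hset i i S a HS Ha Hv). }
    assert (Hvb : v <> b).
    { intros ->; apply (member_not_z' Hset i i S b HS Hb Hv). }
    assert (HvV : v ∈ V) by apply (vertex_of_z' Hset i v Hv).
    assert (Himage : forall p q e e', is_edge_image f e e' -> is_upair e p v ->
      maps f p q -> is_upair e' q v).
    { intros p q e e' Him He Hpq y; rewrite (Him y); split.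
      - intros (x & Hx & Hxy); apply He in Hx; destruct Hx as [->| ->].
        + left; apply Hfm in Hxy, Hpq.
          destruct Hxy as [_ [[? ->]|[[? ->]|(? & ? & ->)]]];
            destruct Hpq as [_ [[? ->]|[[? ->]|(? & ? & ->)]]]; congruence.
        + right; apply Hfm in Hxy; destruct Hxy as [_ [[? _]|[[? _]|(_ & _ & ?)]]];
            congruence.
      - intros [->| ->]; [exists p|exists v]; split; auto; try (apply He; auto).
        apply Hfm; auto 6. }
    assert (Hid : maps f a a).
    { apply (Hdist f Hf); auto.
      intros e e' l He Him Hl.
      assert (Hedge : forall p, p ∈ S -> p ∈ e -> is_upair e p v).
      { intros p Hp Hpe; destruct (HG e He) as (x & y & _ & _ & _ & Hxy).
        assert (HeG : is_edge_of_G A z z' e) by (apply HE, He).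
        apply Hxy in Hpe; destruct Hpe as [<-|<-].
        - rewrite (z'_unique Hset i v y Hv); auto.
          apply (neighbour_of_member Hset i S p e y HS Hp HeG Hxy).
        - apply is_upair_sym in Hxy; rewrite (z'_unique Hset i v x Hv); auto.
          apply (neighbour_of_member Hset i S p e x HS Hp HeG Hxy). }
      destruct (classic (a ∈ e)) as [Hae|Hae].
      { pose proof (Hedge a Ha Hae) as H1.
        assert (H2 : is_upair e' b v).
        { apply (Himage a b e e' Him H1), Hfm; auto. }
        apply is_upair_eq in H1, H2, He1, He2; subst.
        rewrite (function_unique c E K _ l k Hc Hl Hk1); auto. }
      destruct (classic (b ∈ e)) as [Hbe|Hbe].
      { pose proof (Hedge b Hb Hbe) as H1.
        assert (H2 : is_upair e' a v).
        { apply (Himage b a e e' Him H1), Hfm; auto. }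
        apply is_upair_eq in H1, H2, He1, He2; subst.
        rewrite (function_unique c E K _ l k Hc Hl Hk2); auto. }
      assert (e' = e).
      { assert (HeV : subset e V).
        { destruct (HG e He) as (x & y & Hx & Hy & _ & Hxy).
          intros u Hu; apply Hxy in Hu; destruct Hu as [-> | ->]; auto. }
        apply set_ext; intro y; rewrite (Him y); split.
        - intros (x & Hx & Hxy); apply Hfm in Hxy.
          destruct Hxy as [_ [[-> _]|[[-> _]|(_ & _ & ->)]]]; tauto.
        - intro Hy; exists y; split; auto; apply Hfm; split; auto.
          right; right; repeat split; auto; intros ->; contradiction. }
      subst e'; exact Hl. }
    apply Hfm in Hid; tauto.
  - exists K, d; split; auto; apply HK.
Qed.

(** * Paths and components of at most two vertices *)

Lemma trivial_path (V E x : M) :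
  x ∈ V ->
  exists p, is_path V E p empty x x /\
    forall i u, maps p i u <-> i = empty /\ u = x.
Proof.
  intro Hx; destruct omega_exists as [w Hw].
  destruct (function_exists (succ empty) V (fun i u => i = empty /\ u = x))
    as (p & Hp & Hpm0).
  { definability. }
  { intros i Hi; apply in_succ in Hi; destruct Hi as [Hi| ->].
    - destruct (not_in_empty i Hi).
    - exists x; auto. }
  { intros i u v _ [_ ->] [_ ->]; reflexivity. }
  assert (Hpm : forall i u, maps p i u <-> i = empty /\ u = x).
  { intros i u; rewrite Hpm0, in_succ; split; [tauto|].
    intros [-> ->]; auto. }
  exists p; split; auto; split; [|split; [|split; [|split]]].
  - exists w; split; auto; apply omega_empty, Hw.
  - exists (succ empty); rewrite is_succ_eq; split; auto; split; auto.
    intros i j u Hi Hj; apply Hpm in Hi, Hj; destruct Hi, Hj; congruence.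
  - intros o Ho; apply is_empty_eq in Ho; apply Hpm; auto.
  - apply Hpm; auto.
  - intros i j a b Hi; destruct (not_in_empty i Hi).
Qed.

Lemma path_extension (V E p n x y v : M) :
  is_path V E p n x y -> v ∈ V -> adjacent E y v ->
  (forall i, ~ maps p i v) ->
  exists p', is_path V E p' (succ n) x v /\
    forall i u, maps p' i u <-> maps p i u \/ i = succ n /\ u = v.
Proof.
  intros ((w & Hw & Hn) & (l & Hl & Hp & Hinj) & H0 & Hy & Hadj) Hv Hyv Hnew.
  apply is_succ_eq in Hl; subst l.
  assert (Hfresh : forall u, ~ maps p (succ n) u).
  { intros u Hu; apply (mem_irrefl (succ n)).
    apply (function_bounds p (succ n) V (succ n) u Hp Hu). }
  destruct (function_exists (succ (succ n)) V
    (fun i u => maps p i u \/ i = succ n /\ u = v)) as (p' & Hp' & Hpm0).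
  { definability. }
  { intros i Hi; apply in_succ in Hi; destruct Hi as [Hi| ->].
    - destruct (function_value p (succ n) V i Hp Hi) as (u & Hu & Hiu).
      exists u; auto.
    - exists v; auto. }
  { intros i u u' _ [Hu|[-> ->]] [Hu'|[E' ->]].
    - apply (function_unique p (succ n) V i u u' Hp Hu Hu').
    - subst i; destruct (Hfresh u Hu).
    - destruct (Hfresh u' Hu').
    - reflexivity. }
  assert (Hpm : forall i u, maps p' i u <-> maps p i u \/ i = succ n /\ u = v).
  { intros i u; rewrite Hpm0; split; [tauto|]; intro H; split; [|split; auto].
    - rewrite in_succ; destruct H as [H|[-> _]]; auto.
      left; apply (function_bounds p (succ n) V i u Hp H).
    - destruct H as [H|[_ ->]]; auto.
      apply (function_bounds p (succ n) V i u Hp H). }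
  exists p'; split; auto; split; [|split; [|split; [|split]]].
  - exists w; split; auto; apply omega_succ; auto.
  - exists (succ (succ n)); rewrite is_succ_eq; split; auto; split; auto.
    intros i j u Hi Hj; apply Hpm in Hi, Hj.
    destruct Hi as [Hi|[-> ->]], Hj as [Hj|[-> Ej]]; auto.
    + apply (Hinj i j u); auto.
    + subst u; destruct (Hnew i Hi).
    + destruct (Hnew j Hj).
  - intros o Ho; apply Hpm; left; auto.
  - apply Hpm; auto.
  - intros i j a b Hi Hj Ha Hb; apply is_succ_eq in Hj; subst j.
    apply Hpm in Ha, Hb.
    destruct Ha as [Ha|[-> _]]; [|destruct (mem_irrefl _ Hi)].
    apply in_succ in Hi; destruct Hi as [Hi| ->].
    + destruct Hb as [Hb|[Hb _]].
      * apply (Hadj i (succ i)); auto; apply is_succ_eq; auto.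
      * assert (Hs : n ∈ succ i) by (rewrite Hb; apply in_succ; auto).
        apply in_succ in Hs; destruct Hs as [Hs| ->].
        -- destruct (mem_asym n i Hs Hi).
        -- destruct (mem_irrefl i Hi).
    + destruct Hb as [Hb|[_ ->]]; [destruct (Hfresh b Hb)|].
      rewrite (function_unique p (succ n) V n a y Hp Ha Hy); exact Hyv.
Qed.

(** By induction on [i], the [i]-th vertex of the path lies in [S]. *)
Lemma path_stays_in_closed_set (V E p n x y S : M) :
  is_path V E p n x y -> x ∈ S ->
  (forall a b, a ∈ S -> adjacent E a b -> b ∈ S) -> y ∈ S.
Proof.
  intros ((w & Hw & Hn) & (l & Hl & Hp & Hinj) & H0 & Hy & Hadj) Hx Hclosed.
  apply is_succ_eq in Hl; subst l.
  assert (K : forall i, i ∈ w ->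
            i ∈ succ n -> forall a, maps p i a -> a ∈ S).
  { apply (omega_induction w
      (fun i => i ∈ succ n -> forall a, maps p i a -> a ∈ S) Hw).
    - definability.
    - intros _ a Ha; rewrite (function_unique p (succ n) V empty a x Hp Ha); auto.
      apply H0, is_empty_eq; reflexivity.
    - intros i Hi IH Hsi b Hb.
      assert (Hin : i ∈ n).
      { apply in_succ in Hsi; destruct Hsi as [Hsi|<-];
          [|apply in_succ; auto].
        apply (proj1 (omega_ordinal w n Hw Hn) (succ i)); auto.
        apply in_succ; auto. }
      assert (Hin' : i ∈ succ n) by (apply in_succ; auto).
      destruct (function_value p (succ n) V i Hp Hin') as (a & _ & Ha).
      apply (Hclosed a b); [apply (IH Hin' a Ha)|].
      apply (Hadj i (succ i)); auto; apply is_succ_eq; auto. }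
  apply (K n Hn); auto; apply in_succ; auto.
Qed.

(** The component of [x], as a class. *)
Definition reachable (V E x y : M) : Prop :=
  y ∈ V /\ exists p n, is_path V E p n x y.

Lemma reachable_refl (V E x : M) : x ∈ V -> reachable V E x x.
Proof.
  intro Hx; split; auto.
  destruct (trivial_path V E x Hx) as (p & Hp & _); exists p, empty; exact Hp.
Qed.

(** Paths have no repeated vertices, so reachability is not transitive by mere
    concatenation; paths of length one and two are enough for
    the vertices of G_A. *)
Lemma reachable_neighbour (V E x y : M) :
  is_graph V E -> adjacent E x y -> reachable V E x y.
Proof.
  intros HG Hxy; destruct (graph_adjacent V E x y HG Hxy) as (Hx & Hy & Hne).
  split; auto.
  destruct (trivial_path V E x Hx) as (p & Hp & Hpm).
  destruct (path_extension V E p empty x x y Hp Hy Hxy) as (q & Hq & _).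
  { intros i Hi; apply Hpm in Hi; destruct Hi; congruence. }
  exists q, (succ empty); exact Hq.
Qed.

Lemma reachable_second_neighbour (V E x y v : M) :
  is_graph V E -> adjacent E x y -> adjacent E y v -> x <> v ->
  reachable V E x v.
Proof.
  intros HG Hxy Hyv Hxv; destruct (graph_adjacent V E x y HG Hxy) as (Hx & Hy & Hne).
  destruct (graph_adjacent V E y v HG Hyv) as (_ & Hv & Hne').
  split; auto.
  destruct (trivial_path V E x Hx) as (p & Hp & Hpm).
  destruct (path_extension V E p empty x x y Hp Hy Hxy) as (q & Hq & Hqm).
  { intros i Hi; apply Hpm in Hi; destruct Hi; congruence. }
  destruct (path_extension V E q (succ empty) x y v Hq Hv Hyv) as (r & Hr & _).
  { intros i Hi; apply Hqm in Hi; rewrite Hpm in Hi; intuition congruence. }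
  exists r, (succ (succ empty)); exact Hr.
Qed.

Lemma is_one_eq (n : M) : is_one n <-> n = succ empty.
Proof.
  split.
  - intros (o & Ho & Hn); apply is_empty_eq in Ho; apply is_succ_eq in Hn; congruence.
  - intros ->; exists empty; rewrite is_empty_eq, is_succ_eq; auto.
Qed.

Lemma is_two_eq (n : M) : is_two n <-> n = succ (succ empty).
Proof.
  split.
  - intros (k & Hk & Hn); apply is_one_eq in Hk; apply is_succ_eq in Hn; congruence.
  - intros ->; exists (succ empty); rewrite is_one_eq, is_succ_eq; auto.
Qed.

(** K1 and K2 have at most two vertices, hence so has a component isomorphic to one of
    them. *)
Lemma small_component (V E : M) :
  has_K1_or_K2_component V E ->
  exists x, x ∈ V /\
    forall a b c, reachable V E x a -> reachable V E x b -> reachable V E x c ->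
      a = b \/ a = c \/ b = c.
Proof.
  intros (C & F & n & D & (x & Hx & HC) & _ & Hn & _ & f & [[Hf Hinj] _] & _).
  exists x; split; auto; intros a b c Ha Hb Hc.
  apply HC in Ha, Hb, Hc.
  assert (Hval : forall i, i ∈ n -> i = empty \/ i = succ empty).
  { intros i Hi; destruct Hn as [Hn|Hn]; [apply is_one_eq in Hn|apply is_two_eq in Hn];
      subst n; rewrite !in_succ in Hi; pose proof (not_in_empty i); tauto. }
  destruct (function_value f C n a Hf Ha) as (i & Hi & Hai).
  destruct (function_value f C n b Hf Hb) as (j & Hj & Hbj).
  destruct (function_value f C n c Hf Hc) as (k & Hk & Hck).
  pose proof (Hinj a b i Hai); pose proof (Hinj a c i Hai);
    pose proof (Hinj b c j Hbj).
  apply Hval in Hi, Hj, Hk; intuition (subst; auto).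
Qed.

(** Both the component and the graph on [n] are complete, so any bijection between
    their vertex sets is an isomorphism. *)
Lemma complete_component (V E C n f : M) :
  is_graph V E -> is_component V E C -> is_one n \/ is_two n ->
  (forall x y, x ∈ C -> y ∈ C -> x <> y -> adjacent E x y) ->
  is_bijection f C n -> has_K1_or_K2_component V E.
Proof.
  intros HG HC Hn Hcomp Hf.
  destruct (separation (fun e => subset e C) E) as [F HF]; [definability|].
  destruct (graph_on_edges n
    (fun e => exists x y, x ∈ n /\ y ∈ n /\ x <> y /\ is_upair e x y))
    as (D & HD & HDm); [definability|auto|].
  exists C, F, n, D; split; [exact HC|split; [exact HF|split; [exact Hn|]]].
  assert (HDc : is_complete_graph n D).
  { split; auto; intros x y Hx Hy Hxy; exists (upair x y).
    rewrite is_upair_eq; split; auto; apply HDm; exists x, y.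
    rewrite is_upair_eq; auto. }
  split; [exact HDc|].
  exists f; split; [exact Hf|].
  pose proof Hf as [[Hff Hinj] _].
  intros x y x' y' Hx Hy.
  destruct (function_bounds f C n x x' Hff Hx) as [HxC Hxn].
  destruct (function_bounds f C n y y' Hff Hy) as [HyC Hyn].
  split; intro H.
  - apply HDc; auto; intros <-.
    assert (E' : x = y) by (apply (Hinj x y x'); auto); subst y.
    destruct H as (e & He & Hxx); apply HF in He; destruct He as [He _].
    apply (graph_adjacent V E x x HG); [exists e; auto|reflexivity].
  - assert (Hne : x <> y).
    { intros <-; apply (graph_adjacent n D x' y' HD H).
      apply (function_unique f C n x x' y' Hff Hx Hy). }
    destruct (Hcomp x y HxC HyC Hne) as (e & He & Hxy); exists e; split; auto.
    apply HF; split; auto; intros u Hu; apply Hxy in Hu; destruct Hu; subst; auto.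
Qed.

(** A set of vertices reachable from [x] that no edge leaves is the whole
    component of [x]. *)
Lemma component_of_closed_set (V E x C : M) :
  x ∈ C -> subset C V -> (forall y, y ∈ C -> reachable V E x y) ->
  (forall a b, a ∈ C -> adjacent E a b -> b ∈ C) -> is_component V E C.
Proof.
  intros Hx HCV Hreach Hclosed; exists x; split; auto.
  intro y; split; [apply Hreach|].
  intros (_ & p & n & Hp); apply (path_stays_in_closed_set V E p n x y C Hp Hx Hclosed).
Qed.

Lemma isolated_vertex_component (V E x : M) :
  is_graph V E -> x ∈ V -> (forall y, ~ adjacent E x y) ->
  has_K1_or_K2_component V E.
Proof.
  intros HG Hx Hiso.
  assert (HC : forall y, y ∈ upair x x <-> y = x).
  { intro y; rewrite in_upair; tauto. }
  destruct (function_exists (upair x x) (succ empty) (fun _ i => i = empty))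
    as (f & Hf & Hfm).
  { definability. }
  { intros y _; exists empty; rewrite in_succ; auto. }
  { intros y i j _ -> ->; reflexivity. }
  apply (complete_component V E (upair x x) (succ empty) f); auto.
  - apply (component_of_closed_set V E x).
    + apply HC; auto.
    + intros y Hy; apply HC in Hy; subst; auto.
    + intros y Hy; apply HC in Hy; subst; apply reachable_refl; auto.
    + intros a b Ha Hab; apply HC in Ha; subst; destruct (Hiso b Hab).
  - left; apply is_one_eq; auto.
  - intros a b Ha Hb Hab; apply HC in Ha, Hb; congruence.
  - split; [split; auto|].
    + intros a b i Ha Hb; apply Hfm in Ha, Hb.
      destruct Ha as [Ha _], Hb as [Hb _]; apply HC in Ha, Hb; congruence.
    + intros i Hi; exists x; apply Hfm; split; [apply HC; auto|split; auto].
      apply in_succ in Hi; destruct Hi as [Hi|Hi]; auto; destruct (not_in_empty i Hi).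
Qed.

Lemma isolated_edge_component (V E x y : M) :
  is_graph V E -> adjacent E x y ->
  (forall v, adjacent E x v -> v = y) -> (forall v, adjacent E y v -> v = x) ->
  has_K1_or_K2_component V E.
Proof.
  intros HG Hxy Hisox Hisoy.
  destruct (graph_adjacent V E x y HG Hxy) as (Hx & Hy & Hne).
  assert (H01 : succ empty <> empty).
  { intro H; apply (not_in_empty empty); rewrite <- H at 2; apply in_succ; auto. }
  destruct (function_exists (upair x y) (succ (succ empty))
    (fun v i => v = x /\ i = empty \/ v = y /\ i = succ empty)) as (f & Hf & Hfm).
  { definability. }
  { intros v Hv; apply in_upair in Hv; destruct Hv as [-> | ->];
      [exists empty|exists (succ empty)]; rewrite !in_succ; auto. }
  { intros v i j _; intuition congruence. }
  apply (complete_component V E (upair x y) (succ (succ empty)) f); auto.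
  - apply (component_of_closed_set V E x).
    + apply in_upair; auto.
    + intros v Hv; apply in_upair in Hv; destruct Hv; subst; auto.
    + intros v Hv; apply in_upair in Hv; destruct Hv; subst;
        [apply reachable_refl|apply reachable_neighbour]; auto.
    + intros a b Ha Hab; apply in_upair in Ha; apply in_upair.
      destruct Ha as [-> | ->]; auto.
  - right; apply is_two_eq; auto.
  - intros a b Ha Hb Hab; apply in_upair in Ha, Hb.
    destruct Ha as [-> | ->], Hb as [-> | ->]; try congruence; auto.
    apply adjacent_sym; auto.
  - split; [split; auto|].
    + intros a b i Ha Hb; apply Hfm in Ha, Hb.
      destruct Ha as (_ & _ & Ha), Hb as (_ & _ & Hb); intuition congruence.
    + intros i Hi; pose proof Hi as Hi'; rewrite !in_succ in Hi'.
      destruct Hi' as [[Hi'|Hi']|Hi'].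
      * destruct (not_in_empty i Hi').
      * exists x; apply Hfm; rewrite in_upair; auto.
      * exists y; apply Hfm; rewrite in_upair; auto.
Qed.

(** Each vertex [x] reaches two further vertices: [z'_i] and then [z_i] if [x]
    is in [A_i]; [z_(i+1)] and [z'_i] if [x] is [z_i]; [z_i] and some member of
    the nonempty [A_i] if [x] is [z'_i]. *)
Lemma graph_G_no_small_component (w A z z' V E : M) :
  family_setting w A z z' V -> is_graph_G A z z' V E ->
  ~ has_K1_or_K2_component V E.
Proof.
  intros Hset [HV HE] Hsmall.
  assert (HG : is_graph V E) by (apply (graph_G_is_graph Hset E); split; auto).
  destruct (small_component V E Hsmall) as (x & Hx & Hfew).
  assert (Hspine : forall i a b, maps z i a -> maps z (succ i) b -> adjacent E a b).
  { intros i a b Ha Hb; exists (upair a b); rewrite is_upair_eq; split; auto.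
    apply HE; left; exists i, (succ i), a, b; rewrite is_upair_eq, is_succ_eq; auto. }
  assert (Hrung : forall i a b, maps z i a -> maps z' i b -> adjacent E a b).
  { intros i a b Ha Hb; exists (upair a b); rewrite is_upair_eq; split; auto.
    apply HE; right; left; exists i, a, b; rewrite is_upair_eq; auto. }
  assert (Hpend : forall i S a b, maps A i S -> a ∈ S -> maps z' i b ->
            adjacent E a b).
  { intros i S a b HS Ha Hb; exists (upair a b); rewrite is_upair_eq; split; auto.
    apply HE; right; right; exists i, S, a, b; rewrite is_upair_eq; auto. }
  apply HV in Hx as Hxv.
  destruct Hxv as [(i & S & HS & HxS)|[[i Hi]|[i Hi]]].
  - assert (Hi : i ∈ w) by apply (member_index Hset i S HS).
    destruct (z_value Hset i Hi) as [a Ha], (z'_value Hset i Hi) as [b Hb].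
    assert (Hxb : adjacent E x b) by apply (Hpend i S x b HS HxS Hb).
    assert (Hba : adjacent E b a) by (apply adjacent_sym, (Hrung i a b Ha Hb)).
    assert (Hxa : x <> a) by (intros ->; apply (member_not_z Hset i i S a HS HxS Ha)).
    destruct (Hfew x b a) as [E'|[E'|E']].
    + apply reachable_refl; auto.
    + apply reachable_neighbour; auto.
    + apply (reachable_second_neighbour V E x b a); auto.
    + apply (graph_adjacent V E x b HG Hxb), E'.
    + contradiction.
    + apply (graph_adjacent V E b a HG Hba), E'.
  - assert (Hiw : i ∈ w) by apply (z_index Hset i x Hi).
    assert (His : succ i ∈ w) by (apply omega_succ; auto; apply Hset).
    destruct (z_value Hset (succ i) His) as [a Ha], (z'_value Hset i Hiw) as [b Hb].
    assert (Hxa : adjacent E x a) by apply (Hspine i x a Hi Ha).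
    assert (Hxb : adjacent E x b) by apply (Hrung i x b Hi Hb).
    destruct (Hfew x a b) as [E'|[E'|E']].
    + apply reachable_refl; auto.
    + apply reachable_neighbour; auto.
    + apply reachable_neighbour; auto.
    + apply (graph_adjacent V E x a HG Hxa), E'.
    + apply (graph_adjacent V E x b HG Hxb), E'.
    + apply (z_z'_distinct Hset (succ i) i a b Ha Hb), E'.
  - assert (Hiw : i ∈ w) by apply (z'_index Hset i x Hi).
    destruct (z_value Hset i Hiw) as [a Ha].
    pose proof Hset as (_ & ((B & HAf) & Hnonempty & _) & _).
    destruct (function_value A w B i HAf Hiw) as (S & _ & HS).
    destruct (Hnonempty i S HS) as [b Hb].
    assert (Hax : adjacent E a x) by apply (Hrung i a x Ha Hi).
    assert (Hbx : adjacent E b x) by apply (Hpend i S b x HS Hb Hi).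
    destruct (Hfew x a b) as [E'|[E'|E']].
    + apply reachable_refl; auto.
    + apply reachable_neighbour, adjacent_sym; auto.
    + apply reachable_neighbour, adjacent_sym; auto.
    + apply (graph_adjacent V E a x HG Hax); auto.
    + apply (graph_adjacent V E b x HG Hbx); auto.
    + subst b; apply (member_not_z Hset i i S a HS Hb Ha).
Qed.

(** * Colourings obtained from choice *)

Lemma AC_implies_AC1 : AC M -> AC1 M.
Proof.
  intros HAC V E HG.
  destruct (AC_injection_into_cardinal V HAC) as (K & c & HK & Hc & Hinj).
  exists K, c; split; [|split]; auto.
  intros f [[[Hf _] _] _] Hpres x Hx.
  destruct (function_value f V V x Hf Hx) as (y & _ & Hxy).
  destruct (function_value c V K x Hc Hx) as (k & _ & Hk).
  rewrite <- (Hinj x y k Hk (Hpres x y k Hxy Hk)) in Hxy; exact Hxy.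
Qed.

Lemma AC_implies_AC3 : AC M -> AC3 M.
Proof.
  intros HAC V E HG.
  destruct (AC_injection_into_cardinal E HAC) as (K & c & HK & Hc & Hinj).
  exists K, c; split; [|split]; auto.
  intros e e' k l _ _ Hne _ Hk Hl ->; apply Hne, (Hinj e e' l); auto.
Qed.

Lemma AC_implies_AC4 : AC M -> AC4 M.
Proof.
  intros HAC V E HG.
  destruct (AC_injection_into_cardinal V HAC) as (K & c & HK & Hc & Hinj).
  exists K, c; split; [|split]; auto.
  intros x y k l Hxy Hk Hl ->.
  apply (graph_adjacent V E x y HG) in Hxy; apply Hxy, (Hinj x y l); auto.
Qed.

(** Let all edges have different colours, and let the automorphism [f] move [x].
    Since [f] fixes every edge at [x], each such edge joins [x] to [f x], so there is
    at most one; the same holds at [f x], which [f] moves back to [x].  Hence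
    [x] is isolated, or [x] and [f x] form a component. *)
Lemma AC_implies_AC2 : AC M -> AC2 M.
Proof.
  intros HAC V E HG Hsmall.
  destruct (AC_injection_into_cardinal E HAC) as (K & c & HK & Hc & Hinj).
  exists K, c; split; [|split]; auto.
  intros f [[[Hf Hfinj] _] Hiso] Hpres x Hx.
  assert (Hfix : forall u v u' v', adjacent E u v -> maps f u u' -> maps f v v' ->
            u' = u /\ v' = v \/ u' = v /\ v' = u).
  { intros u v u' v' Huv Hu Hv.
    destruct Huv as (e & He & Huv).
    destruct (function_value c E K e Hc He) as (k & _ & Hk).
    assert (Him : is_edge_image f e (upair u' v')).
    { intro y; rewrite in_upair; split.
      - intros [-> | ->]; [exists u|exists v]; split; auto; apply Huv; auto.
      - intros (t & Ht & Hty); apply Huv in Ht; destruct Ht as [-> | ->];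
          [left|right]; eapply (function_unique f V V); eauto. }
    pose proof (Hinj _ _ _ Hk (Hpres _ _ _ He Him Hk)) as Ee.
    apply (is_upair_cases e); auto; apply is_upair_eq; auto. }
  destruct (function_value f V V x Hf Hx) as (x' & _ & Hxx').
  destruct (classic (x' = x)) as [->|Hmove]; auto.
  exfalso; apply Hsmall.
  destruct (classic (exists y, adjacent E x y)) as [[y Hxy]|Hno].
  2: { apply (isolated_vertex_component V E x HG Hx).
       intros y Hy; apply Hno; exists y; auto. }
  destruct (graph_adjacent V E x y HG Hxy) as (_ & Hy & Hne).
  assert (Hx'_y : forall v, adjacent E x v -> x' = v /\ maps f v x).
  { intros v Hxv; destruct (graph_adjacent V E x v HG Hxv) as (_ & Hv & _).
    destruct (function_value f V V v Hf Hv) as (v' & _ & Hvv').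
    destruct (Hfix x v x' v' Hxv Hxx' Hvv') as [[? _]|[-> ->]]; [contradiction|auto]. }
  destruct (Hx'_y y Hxy) as [-> Hyx].
  apply (isolated_edge_component V E x y HG Hxy).
  - intros v Hv; symmetry; apply Hx'_y; auto.
  - intros v Hyv; destruct (graph_adjacent V E y v HG Hyv) as (_ & Hv & _).
    destruct (function_value f V V v Hf Hv) as (v' & _ & Hvv').
    destruct (Hfix y v x v' Hyv Hyx Hvv') as [[? _]|[? _]]; congruence.
Qed.

(** * The graph conditions imply their instances *)

Lemma AC1_implies_AC5 : AC1 M -> AC5 M.
Proof.
  intros H w A z z' V E Hw HA Hz HE.
  assert (Hset : family_setting w A z z' V) by (split; [|split; [|split]]; auto; apply HE).
  apply H, (graph_G_is_graph Hset E HE).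
Qed.

Lemma AC2_implies_AC6 : AC2 M -> AC6 M.
Proof.
  intros H w A z z' V E Hw HA Hz HE.
  assert (Hset : family_setting w A z z' V) by (split; [|split; [|split]]; auto; apply HE).
  apply H; [apply (graph_G_is_graph Hset E HE)|].
  apply (graph_G_no_small_component w A z z' V E Hset HE).
Qed.

Lemma AC3_implies_AC7 : AC3 M -> AC7 M.
Proof.
  intros H w A z z' V E Hw HA Hz HE.
  assert (Hset : family_setting w A z z' V) by (split; [|split; [|split]]; auto; apply HE).
  apply H, (graph_G_is_graph Hset E HE).
Qed.

Lemma AC4_implies_AC8 : AC4 M -> AC8 M.
Proof.
  intros H w A z z' V E Hw HA Hz HE.
  assert (Hset : family_setting w A z z' V) by (split; [|split; [|split]]; auto; apply HE).
  apply H, (graph_H_is_graph Hset E HE).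
Qed.

End ZF.

Theorem theorem7 (M : set_structure) (HM : is_ZF M) :
  (AC M <-> AC1 M) /\
  (AC M <-> AC2 M) /\
  (AC M <-> AC3 M) /\
  (AC M <-> AC4 M) /\
  (AC M <-> AC5 M) /\
  (AC M <-> AC6 M) /\
  (AC M <-> AC7 M) /\
  (AC M <-> AC8 M).
Proof.
  pose proof (AC_implies_AC1 HM); pose proof (AC_implies_AC2 HM); pose proof (AC_implies_AC3 HM);
    pose proof (AC_implies_AC4 HM).
  pose proof (AC1_implies_AC5 HM); pose proof (AC2_implies_AC6 HM); pose proof (AC3_implies_AC7 HM);
    pose proof (AC4_implies_AC8 HM).
  pose proof (AC5_implies_AC HM); pose proof (AC6_implies_AC HM); pose proof (AC7_implies_AC HM);
    pose proof (AC8_implies_AC HM).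
  tauto.
Qed.
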